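(* Let $k\ge 0$ be an integer and let $\Sigma\in\mathbb R^{d\times \ell}$ with $\ell\le d$. Assume that $\underline f$ and $\underline\sigma$ are bounded by some constant $C$ uniformly in $x\in\mathbb R^d$, and let $M$ be an upper bound of $\|\Sigma\Sigma^{\mathsf T}\|$. Then there exists $K=K(C,M)>0$ such that, for all $v\in\mathcal C^4_{\rm b}([0,T]\times\mathbb R^d)$ and all $(t,x)\in\mathcal T_h\times\mathbb R^d$, \begin{align*} &\Big| h^{-1}\mathbb E\big[v(t+h,\hat X(t+h))\,\mathcal P^2_{\Sigma,k}(h^{-1/2}W^t_h)\mid \hat X(t)=x\big]-\tfrac12\operatorname{tr}\big(\underline\sigma(x)\Sigma\Sigma^{\mathsf T}\underline\sigma(x)^{\mathsf T} D^2v(t,x)\big)\Big|\\ &\le K(1+\sqrt h)^4\Big[h\big(|\partial_t^1D^2v|+|\partial_t^0D^3v|+|\partial_t^0D^4v|\big)+h\sqrt h\,|\partial_t^1D^3v|+h^2|\partial_t^2D^2v|\\ &\qquad\qquad\qquad\quad+h^2\sqrt h\,|\partial_t^3D^1v|+h^3|\partial_t^4D^0v|\Big]. \end{align*}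
   Context: $T>0$, $d\ge1$, and $h>0$ is a time step such that $T/h$ is an integer; $\mathcal T_h=\{0,h,2h,\dots,T-h\}$. The constant $K$ does not depend on $h$, $t$, $x$, $v$ (the integers $d$ and $k$ are fixed). $(W_s)_{s\ge0}$ is a $d$-dimensional Brownian motion and $W^t_h:=W_{t+h}-W_t$. $\underline f:\mathbb R^d\to\mathbb R^d$ and $\underline\sigma:\mathbb R^d\to\mathbb R^{d\times d}$ are given, and $\hat X$ is the Euler scheme $$\hat X(t+h)=\hat X(t)+\underline f(\hat X(t))h+\underline\sigma(\hat X(t))(W_{t+h}-W_t).$$ For $\Sigma\in\mathbb R^{d\times\ell}$ with columns $\Sigma_{.j}$, and $w\in\mathbb R^d$, $$\mathcal P^2_{\Sigma,k}(w)=\sum_{j=1}^{\ell}\|\Sigma_{.j}\|_2^2\left(c_k\Big(\frac{[\Sigma^{\mathsf T}w]_j}{\|\Sigma_{.j}\|_2}\Big)^{4k+2}-d_k\right),\quad c_k=\frac1{(4k+2)\,\mathbb E[N^{4k+2}]},\quad d_k=\frac1{4k+2},$$ where $N$ is a one-dimensional standard normal random variable and the $j$th term is zero by convention when $\|\Sigma_{.j}\|_2=0$. $[x]_i$ denotes the $i$th coordinate of a vector. $\mathcal C^k_{\rm b}([0,T]\times\mathbb R^d)$ is the set of functions $[0,T]\times\mathbb R^d\to\mathbb R$ with continuous and bounded partial derivatives up to order $k$ in $t$ and $x$. $D$, $D^2$ are the gradient and Hessian in $x$. For integers $p,q\ge 0$, $$|\partial_t^pD^q\phi|=\sup_{(t,x)\in[0,T]\times\mathbb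 R^d,\ \beta\in\mathbb N^d,\ \sum_i\beta_i=q}\Big|\frac{\partial^{p+q}\phi}{\partial t^p\partial x_1^{\beta_1}\cdots\partial x_d^{\beta_d}}(t,x)\Big|.$$ $\|\cdot\|$ denotes any fixed norm on $\mathbb R^d$ or $\mathbb R^{d\times d}$. *)

(* Defs.v *)
From HB Require Import structures.
From mathcomp Require Import all_boot all_order all_algebra.
From mathcomp Require Import all_classical all_reals all_analysis.

Set Implicit Arguments.
Unset Strict Implicit.
Unset Printing Implicit Defensive.

Import Order.TTheory GRing.Theory Num.Theory.
Import numFieldNormedType.Exports.

Local Open Scope classical_set_scope.
Local Open Scope ring_scope.

(* Vectors of R^d are column vectors 'cV[R]_d; [x]_i is x i 0. *)

Definition is_norm (R : realType) (V : lmodType R) (N : V -> R) : Prop :=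
  [/\ forall x, N x = 0 -> x = 0,
      forall a x, N (a *: x) = `|a| * N x &
      forall x y, N (x + y) <= N x + N y].

Definition grid (R : realType) (T h : R) : set R :=
  [set t | exists2 i : nat, t = i%:R * h & t <= T - h].

Section Smoothness.
Context {R : realType} {d : nat}.
Implicit Types v : R -> 'cV[R]_d -> R.

(* A function on [0, T] x R^d is represented by a total v : R -> 'cV_d -> R of
   which only the restriction to [0, T] x R^d is ever used.  In particular the
   time derivative is the limit of difference quotients at points of [0, T],
   hence a one-sided derivative at 0 and at T. *)
Definition time_quotient v (t : R) (x : 'cV[R]_d) (s : R) : R :=
  (v s x - v t x) / (s - t).

(* A direction None stands for t, and Some i for x_i. *)
Definition has_partial (T : R) (a : option 'I_d) v (t : R) (x : 'cV[R]_d) :=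
  match a with
  | None => cvg (time_quotient v t x @ within `[0, T] (t^'))
  | Some i => derivable (v t) x (delta_mx i 0)
  end.

Definition partial (T : R) (a : option 'I_d) v : R -> 'cV[R]_d -> R :=
  fun t x => match a with
  | None => lim (time_quotient v t x @ within `[0, T] (t^'))
  | Some i => 'D_(delta_mx i 0) (v t) x
  end.

(* Iterated partial derivative; the head of the word is applied last, as in
   the usual notation. *)
Definition partials (T : R) (w : seq (option 'I_d)) v : R -> 'cV[R]_d -> R :=
  foldr (partial T) v w.

(* All iterated partials of total order at most k in (t, x), in whatever order
   the variables are taken and including order 0, exist, are continuous and
   are bounded on [0, T] x R^d. *)
Definition Cb (k : nat) (T : R) v : Prop :=
  forall w : seq (option 'I_d), (size w <= k)%N ->
  [/\ {within `[0, T] `*` [set: 'cV[R]_d],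
        continuous (fun p : R * 'cV[R]_d => partials T w v p.1 p.2)},
      exists B : R, forall t x, t \in `[0, T] -> `|partials T w v t x| <= B &
      (size w < k)%N -> forall a t x, t \in `[0, T] ->
        has_partial T a (partials T w v) t x].

(* The word t^p x_1^(beta_1) ... x_d^(beta_d). *)
Definition deriv_word (p : nat) (beta : 'I_d -> nat) : seq (option 'I_d) :=
  nseq p None ++ flatten [seq nseq (beta i) (Some i) | i <- enum 'I_d].

(* |d_t^p D^q phi| *)
Definition seminorm (T : R) (p q : nat) v : R :=
  sup [set y : R | exists t x (beta : 'I_d -> nat),
    [/\ t \in `[0, T], (\sum_i beta i)%N = q &
        y = `|partials T (deriv_word p beta) v t x|]].

Definition hessian (T : R) v (t : R) (x : 'cV[R]_d) : 'M[R]_d :=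
  \matrix_(i, j) partials T [:: Some i; Some j] v t x.

End Smoothness.

Section Polynomial.
Context {R : realType}.

Definition gauss_moment (n : nat) : R :=
  fine 'E_(normal_prob (0 : R) 1)[fun x : R => x ^+ n].

Definition c_ (k : nat) : R := ((4 * k + 2)%:R * gauss_moment (4 * k + 2))^-1.

Definition d_ (k : nat) : R := ((4 * k + 2)%:R)^-1.

Definition norm2 (n : nat) (u : 'cV[R]_n) : R :=
  Num.sqrt (\sum_i u i 0 ^+ 2).

Definition P2 (d l : nat) (Sigma : 'M[R]_(d, l)) (k : nat) (w : 'cV[R]_d) : R :=
  \sum_(j < l)
    if norm2 (col j Sigma) == 0 then 0 else
    norm2 (col j Sigma) ^+ 2 *
      (c_ k * ((Sigma^T *m w) j 0 / norm2 (col j Sigma)) ^+ (4 * k + 2) - d_ k).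

End Polynomial.

Section Probability.
Context {R : realType} {d : nat} {disp : measure_display}
        {Omega : measurableType disp} (P : probability Omega R).

Definition increment (W : R -> Omega -> 'cV[R]_d) (s t : R) (omega : Omega) :
  'cV[R]_d := W t omega - W s omega.

(* Standard d-dimensional Brownian motion.  The second parameter of
   normal_prob is the standard deviation. *)
Definition brownian_motion (W : R -> Omega -> 'cV[R]_d) : Prop :=
  [/\ {ae P, forall omega, W 0 omega = 0},
      forall t i, 0 <= t ->
        measurable_fun [set: Omega] (fun omega => W t omega i 0 : R),
      forall s t i (B : set R), 0 <= s -> s < t -> measurable B ->
        P [set omega | B (increment W s t omega i 0)] =
          normal_prob 0 (Num.sqrt (t - s)) B,
      (* joint independence of all coordinates of successive increments *)
      forall (n : nat) (tm : nat -> R) (B : 'I_n -> 'I_d -> set R),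
        0 <= tm 0 -> (forall j, tm j < tm j.+1) ->
        (forall j i, measurable (B j i)) ->
        P [set omega | forall (j : 'I_n) (i : 'I_d),
                        B j i (increment W (tm j) (tm j.+1) omega i 0)] =
        (\prod_(j < n) \prod_(i < d)
           P [set omega | B j i (increment W (tm j) (tm j.+1) omega i 0%R)])%E &
      {ae P, forall omega, {within `[0, +oo[, continuous (W ^~ omega)}}].

Definition borel : set (set 'cV[R]_d) :=
  <<s [set U : set 'cV[R]_d | open U] >>.

(* x |-> g x is a version of x |-> E[Y | Z = x]. *)
Definition is_cond_exp (Y : Omega -> R) (Z : Omega -> 'cV[R]_d)
    (g : 'cV[R]_d -> R) : Prop :=
  [/\ forall B : set R, measurable B -> borel (g @^-1` B),
      P.-integrable [set: Omega] (EFin \o (g \o Z)) &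
      forall B, borel B ->
        (\int[P]_(omega in Z @^-1` B) (g (Z omega))%:E =
         \int[P]_(omega in Z @^-1` B) (Y omega)%:E)%E].

(* X is the Euler scheme issued from the point x0 at the time t0. *)
Definition euler_scheme (T h : R) (f : 'cV[R]_d -> 'cV[R]_d)
    (sigma : 'cV[R]_d -> 'M[R]_d) (W : R -> Omega -> 'cV[R]_d)
    (t0 : R) (x0 : 'cV[R]_d) (X : R -> Omega -> 'cV[R]_d) : Prop :=
  (forall omega, X t0 omega = x0) /\
  (forall t omega, grid T h t -> t0 <= t ->
     X (t + h) omega =
       X t omega + h *: f (X t omega)
       + sigma (X t omega) *m increment W t (t + h) omega).

(* x |-> g x is the conditional expectation
     E[v(t+h, X(t+h)) Q(h^(-1/2) (W_(t+h) - W_t)) | X(t) = x]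
   of the Markov chain X.  For one given initial condition, conditional
   expectations given X(t) are only defined up to a null set of the law of
   X(t); here g must be a common version for all the initial conditions
   X(t0) = x0 with t0 <= t.  The case t0 = t makes g unique at every point
   x. *)
Definition is_euler_cond_exp (T h : R) (f : 'cV[R]_d -> 'cV[R]_d)
    (sigma : 'cV[R]_d -> 'M[R]_d) (W : R -> Omega -> 'cV[R]_d)
    (v : R -> 'cV[R]_d -> R) (Q : 'cV[R]_d -> R) (t : R)
    (g : 'cV[R]_d -> R) : Prop :=
  forall t0 x0 X, grid T h t0 -> t0 <= t ->
    euler_scheme T h f sigma W t0 x0 X ->
    is_cond_exp
      (fun omega => v (t + h) (X (t + h) omega) *
         Q ((Num.sqrt h)^-1 *: increment W t (t + h) omega))
      (X t) g.

End Probability.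

(* Main.v *)
Require Import Defs.
From HB Require Import structures.
From mathcomp Require Import all_boot all_order all_algebra.
From mathcomp Require Import all_classical all_reals all_analysis.
From mathcomp Require Import measurable_realfun ring lra.
Import Order.TTheory GRing.Theory Num.Theory.
Import numFieldNormedType.Exports.
Local Open Scope classical_set_scope.
Local Open Scope ring_scope.

(** Starting the scheme at time t from the point x, the conditional expectation
at x is an ordinary expectation: g x = E[u (x' + y) Q], with u = v (t + h, .),
x' = x + h f(x), y = sqrt h sigma(x) Z, Q = P2(Z) and Z a standard Gaussian
vector, the rescaled increment of the Brownian motion
([euler_cond_exp_value]).

The weight Q is built so that its moments against Z select a second
derivative:
E[Q] = 0,  E[Z_i Q] = 0,  E[Z_i Z_j Q] = (Sigma Sigma^T)_ij,
E[Z_i Z_j Z_m Q] = 0.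
The odd moments vanish by parity.  For the even ones, Gaussian integration by
parts gives, for a unit vector e and an even exponent p,
E[(e.Z)^p Z_i Z_j] = E[N^p] (delta_ij + p e_i e_j),
and with p = 4k+2 the constants c_k and d_k are those that remove the
delta_ij and leave e_i e_j; summing over the columns of Sigma, weighted by
their squared norms, gives Sigma Sigma^T ([has_mean_P2_0] to [has_mean_P2_3]).

Insert the Taylor expansion of u at x' to order four, in space only.  The
terms of order 0, 1 and 3 have zero expectation against Q, the term of order 2
yields h/2 tr(sigma Sigma Sigma^T sigma^T D^2 u(x')), and the remainder, at most
|D^4 v| (sum_i |y_i|)^4 with y of size sqrt h, contributes O(h^2) |D^4 v|
([one_step_expansion]).
After division by h it remains to move D^2 v from (t + h, x') to (t, x): the
mean value theorem in space costs h |f| |D^3 v| and the one in time costs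
h |d_t D^2 v|.  So the error is at most
K h (|d_t D^2 v| + |D^3 v| + |D^4 v|), which the right-hand side dominates.

The seminorms see only the derivatives taken in the order t, x_1, ..., x_d,
whereas the expansion along y produces the space derivatives in every order;
[Dword_perm], the symmetry of mixed derivatives, identifies them. *)

Set Implicit Arguments.
Unset Strict Implicit.
Unset Printing Implicit Defensive.

(** * Integrals with a given finite value *)

(** Integrability and value are kept together so that linear combinations of
such statements carry both at once. *)
Definition has_mean (R : realType) (disp : measure_display)
    (T : measurableType disp) (mu : {measure set T -> \bar R})
    (Y : T -> R) (m : R) : Prop :=
  mu.-integrable setT (EFin \o Y) /\ (\int[mu]_x (Y x)%:E = m%:E)%E.

Lemma maxr_posneg (R : realType) (x : R) : x = Num.max x 0 - Num.max (- x) 0.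
Proof.
have [x0|x0] := leP x 0; first by rewrite max_l ?oppr_ge0// opprK add0r.
by rewrite max_r ?subr0// oppr_le0 ltW.
Qed.

Section HasMean.
Context {R : realType} {disp : measure_display} {T : measurableType disp}.
Variable mu : {measure set T -> \bar R}.

Lemma has_mean_measurable (Y : T -> R) m :
  has_mean mu Y m -> measurable_fun setT Y.
Proof. by move=> [] /measurable_int /measurable_EFinP. Qed.

Lemma has_mean_unique (Y : T -> R) m m' :
  has_mean mu Y m -> has_mean mu Y m' -> m = m'.
Proof. by move=> [_ e] [_]; rewrite e => -[]. Qed.

Lemma has_meanD (Y Y' : T -> R) m m' :
  has_mean mu Y m -> has_mean mu Y' m' ->
  has_mean mu (fun x => Y x + Y' x) (m + m').
Proof.
move=> [iY eY] [iY' eY']; split; first exact: (integrableD _ iY iY').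
by rewrite (integralD _ iY iY')//= EFinD; congr (_ + _)%E.
Qed.

Lemma has_meanZ (c : R) (Y : T -> R) m :
  has_mean mu Y m -> has_mean mu (fun x => c * Y x) (c * m).
Proof.
move=> [iY eY]; split; first exact: (integrableZl _ c iY).
by rewrite (integralZl _ iY)//= EFinM; congr (_ * _)%E.
Qed.

Lemma has_mean0 : has_mean mu (fun=> 0) 0.
Proof. by split; [exact: integrable0|rewrite integral0]. Qed.

Lemma has_mean_sum (I : Type) (r : seq I) (Y : I -> T -> R) (m : I -> R) :
  (forall i, has_mean mu (Y i) (m i)) ->
  has_mean mu (fun x => \sum_(i <- r) Y i x) (\sum_(i <- r) m i).
Proof.
move=> h; elim: r => [|i r IH].
  rewrite big_nil; have -> : (fun x => \sum_(i <- [::]) Y i x) = (fun=> 0).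
    by apply/funext => x; rewrite big_nil.
  exact: has_mean0.
rewrite big_cons; have -> : (fun x => \sum_(i <- i :: r) Y i x) =
    (fun x => Y i x + \sum_(i <- r) Y i x).
  by apply/funext => x; rewrite big_cons.
exact: has_meanD.
Qed.

Lemma has_mean_norm_le (Y G : T -> R) m :
  measurable_fun setT Y -> (forall x, `|Y x| <= G x) -> has_mean mu G m ->
  exists2 m', has_mean mu Y m' & `|m'| <= m.
Proof.
move=> mY YG [iG eG].
have iY : mu.-integrable setT (EFin \o Y).
  apply: (le_integrable measurableT _ _ iG); first exact/measurable_EFinP.
  by move=> x _; rewrite /= lee_fin (le_trans (YG x))// ler_norm.
have fY := integrable_fin_num measurableT iY.
exists (fine (\int[mu]_x (Y x)%:E)%E); first by split => //; rewrite fineK.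
rewrite -lee_fin -abse_EFin fineK// -eG.
apply: (le_trans (le_abse_integral mu measurableT _)); first exact/measurable_EFinP.
apply: ge0_le_integral => //=.
- exact/measurable_EFinP/measurableT_comp.
- exact: (measurable_int mu iG).
- by move=> x _; rewrite lee_fin.
Qed.

Lemma has_mean_ge0 (Y : T -> R) m :
  (forall x, 0 <= Y x) -> has_mean mu Y m -> 0 <= m.
Proof.
move=> Y0 [_ eY]; rewrite -lee_fin -eY; apply: integral_ge0 => x _.
by rewrite lee_fin.
Qed.

(** The form in which results on nonnegative functions are transferred to signed
ones. *)
Lemma has_mean_posneg (Y : T -> R) m : has_mean mu Y m ->
  exists m1 m2, [/\ has_mean mu (fun x => Num.max (Y x) 0) m1,
    has_mean mu (fun x => Num.max (- Y x) 0) m2 & m = m1 - m2].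
Proof.
move=> hY; have mY := has_mean_measurable hY.
have habs : exists2 m', has_mean mu (fun x => `|Y x|) m' & True.
  have [iY _] := hY.
  have iN : mu.-integrable setT (EFin \o (fun x => `|Y x|)).
    by apply: (integrable_abse iY).
  exists (fine (\int[mu]_x (`|Y x|)%:E)%E) => //; split => //.
  by rewrite fineK//; exact: (integrable_fin_num measurableT iN).
have [m0 hN _] := habs.
have [m1 h1 _] : exists2 m1, has_mean mu (fun x => Num.max (Y x) 0) m1 &
    `|m1| <= m0.
  apply: has_mean_norm_le hN; first exact: measurable_maxr.
  by move=> x; rewrite ger0_norm ?le_max ?lexx ?orbT// ge_max normr_ge0 ler_norm.
have [m2 h2 _] : exists2 m2, has_mean mu (fun x => Num.max (- Y x) 0) m2 &
    `|m2| <= m0.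
  apply: has_mean_norm_le hN.
    by apply: measurable_maxr => //; exact: measurableT_comp.
  move=> x; rewrite ger0_norm ?le_max ?lexx ?orbT// ge_max normr_ge0 -normrN.
  by rewrite ler_norm.
exists m1, m2; split => //.
apply: has_mean_unique hY _.
have -> : Y = fun x => Num.max (Y x) 0 + (-1) * Num.max (- Y x) 0.
  by apply/funext => x; rewrite mulN1r -maxr_posneg.
by have := has_meanD h1 (has_meanZ (-1) h2); rewrite mulN1r.
Qed.

End HasMean.

(** * Measures with a density *)

Section Density.
Context {R : realType} {d1 d2 : measure_display}.
Context {T1 : measurableType d1} {T2 : measurableType d2}.
Variables (mu : {measure set T1 -> \bar R}) (nu : {measure set T2 -> \bar R}).
Variables (phi : T1 -> T2) (V : T1 -> R).
Hypothesis mphi : measurable_fun setT phi.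
Hypothesis mV : measurable_fun setT V.
Hypothesis V0 : forall x, 0 <= V x.
Hypothesis muV : forall A, measurable A ->
  (\int[mu]_(x in phi @^-1` A) (V x)%:E = nu A)%E.

Import HBNNSimple.

(** The measure nu is the image under phi of the measure of density V.  With phi
the identity this is integration against a probability density; with phi a
random variable independent of V it is a change of law in which V is frozen.
Both sides agree on indicators by hypothesis, hence on simple functions, hence
on nonnegative functions by monotone convergence. *)
Lemma ge0_integral_density (f : T2 -> R) :
  measurable_fun setT f -> (forall y, 0 <= f y) ->
  (\int[nu]_y (f y)%:E = \int[mu]_x (f (phi x) * V x)%:E)%E.
Proof.
move=> mf f0.
have mef : measurable_fun setT (EFin \o f) by exact/measurable_EFinP.
pose h := nnsfun_approx measurableT mef.
transitivity (limn (fun n => \int[nu]_x (h n x)%:E)%E).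
  rewrite -monotone_convergence//.
  - apply: eq_integral => y _; apply/esym/cvg_lim => //.
    by apply: cvg_nnsfun_approx => // *; rewrite /= lee_fin.
  - by move=> n; exact/measurable_EFinP/measurable_funP.
  - by move=> n y _; rewrite lee_fin.
  - by move=> y _ m n mn; rewrite lee_fin; exact/lefP/nd_nnsfun_approx.
have mhp n : measurable_fun setT (h n \o phi) by exact: measurableT_comp.
transitivity (limn (fun n => \int[mu]_x (h n (phi x) * V x)%:E)%E); last first.
  rewrite -monotone_convergence//.
  - apply: eq_integral => x _; apply/cvg_lim => //.
    under eq_fun do rewrite EFinM.
    rewrite EFinM; apply: cvgeZr => //.
    by apply: cvg_nnsfun_approx => // *; rewrite /= lee_fin.
  - by move=> n; apply/measurable_EFinP; exact: (measurable_funM (mhp n) mV).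
  - by move=> n x _; rewrite lee_fin mulr_ge0.
  - move=> x _ m n mn; rewrite lee_fin ler_wpM2r//.
    exact/lefP/nd_nnsfun_approx.
congr (limn _); apply/funext => n.
transitivity (\int[nu]_x
   (\sum_(y \in range (h n)) (y * \1_(h n @^-1` [set y]) x)%:E))%E.
  by apply: eq_integral => t tE; rewrite /= fimfunE -fsumEFin.
have indich m r :
    measurable_fun setT (fun x => (r * \1_(h m @^-1` [set r]) x)%:E).
  by apply: (measurable_comp measurableT) => //; exact: measurable_funM.
have mind m r :
    measurable_fun setT (fun x => \1_(h m @^-1` [set r]) (phi x) * V x : R).
  apply: measurable_funM => //.
  exact: (measurableT_comp (@measurable_indic _ _ _ _ _ _)).
rewrite ge0_integral_fsum//; last by move=> m y Ey; exact: nnfun_muleindic_ge0.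
transitivity (\int[mu]_x (\sum_(y \in range (h n))
    (y * (\1_(h n @^-1` [set y]) (phi x) * V x))%:E))%E; last first.
  apply: eq_integral => x _; rewrite fimfunE fsumEFin//; congr (_%:E).
  by rewrite mulr_fsuml; apply: eq_fsbigr => y _; rewrite mulrA.
rewrite ge0_integral_fsum//; last 2 first.
  - by move=> y; apply/measurable_EFinP; exact: measurable_funM.
  - move=> y x _; rewrite mulrA lee_fin mulr_ge0// -lee_fin.
    exact: nnfun_muleindic_ge0.
apply: eq_fsbigr => r; rewrite inE => -[y _ <-]; set r' := h n y.
rewrite integralZl_indic_nnsfun//.
under [RHS]eq_integral do rewrite EFinM.
rewrite ge0_integralZl//; last 3 first.
- exact/measurable_EFinP.
- by move=> x _; rewrite lee_fin mulr_ge0.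
- by rewrite lee_fin.
congr (_ * _)%E; rewrite integral_indic// setIT -muV//.
rewrite [LHS]integral_mkcond/=; apply: eq_integral => x _.
rewrite epatch_indic /=.
by rewrite mulrC EFinM.
Qed.

End Density.

(** * Moments of the centred normal law *)

Section VanishingIntegral.
Context {R : realType}.

Lemma ge0_has_mean d (T : measurableType d) (mu : {measure set T -> \bar R})
    (Y : T -> R) m : measurable_fun setT Y -> (forall x, 0 <= Y x) ->
  (\int[mu]_x (Y x)%:E = m%:E)%E -> has_mean mu Y m.
Proof.
move=> mY Y0 eY; split => //; apply/integrableP; split.
  exact/measurable_EFinP.
under eq_integral do rewrite /= ger0_norm//.
by rewrite eY ltry.
Qed.

(** The decay of F in 1/|x| cancels the boundary terms of the integral of F' over
[-n, n]; dominated convergence lets n grow. *)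
Lemma integral_derivative_eq0 (F f : R -> R) (B m : R) :
  (forall x : R, is_derive x 1 F (f x)) -> continuous f ->
  (forall x, `|x * F x| <= B) ->
  has_mean (@lebesgue_measure R) f m -> m = 0.
Proof.
move=> dF cf FB [intf ef].
pose S (n : nat) : set R := `[- n.+1%:R, n.+1%:R]%classic.
pose f_ n := (EFin \o f) \_ (S n).
have mf : measurable_fun setT (EFin \o f) by exact: (measurable_int _ intf).
have int_f_ : (\int[lebesgue_measure]_x f_ n x)%E @[n --> \oo] --> m%:E.
  rewrite -ef.
  have [] := @dominated_convergence _ _ _ (@lebesgue_measure R) setT
    measurableT f_ (EFin \o f) (abse \o (EFin \o f)).
  - by move=> n; apply/(measurable_restrictT _ (measurable_itv _)); exact: measurable_funTS.
  - exact: mf.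
  - apply: aeW => x _.
    apply: cvg_near_cst; near=> n.
    rewrite /f_ patchE ifT// inE /S/= in_itv/=.
    rewrite -ler_norml; near: n.
    exists (Num.truncn `|x|).+1 => // n /= xn.
    apply: ltW; rewrite (lt_le_trans (truncnS_gt _))// ler_nat.
    exact: (leq_trans xn).
  - exact: integrable_abse.
  - apply: aeW => x n _; rewrite /f_ patchE; case: ifP => // _.
    by rewrite (_ : point = 0%E)// abse0 /= lee_fin.
  - by move=> _ _.
have F_ n : (\int[lebesgue_measure]_x f_ n x = (F n.+1%:R - F (- n.+1%:R))%:E)%E.
  rewrite -integral_mkcond EFinB.
  apply: continuous_FTC2.
  - by rewrite gtrN.
  - exact: continuous_subspaceT.
  - have cF : continuous F.
      move=> x; apply: differentiable_continuous; apply/derivable1_diffP.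
      by have [] := dF x.
    split.
    + by move=> x _; have [] := dF x.
    + by apply: cvg_at_right_filter; exact: cF.
    + by apply: cvg_at_left_filter; exact: cF.
  - by move=> x _; rewrite derive1E; apply: (@derive_val _ _ _ _ _ _ _ (dF x)).
have F0 : F n.+1%:R - F (- n.+1%:R) @[n --> \oo] --> (0 : R).
  have B2 : (2 * B) * n.+1%:R^-1 @[n --> \oo] --> (0 : R).
    rewrite -[X in _ --> X](mulr0 (2 * B)).
    by apply: cvgMr; exact: cvg_harmonic.
  apply: norm_cvg0; apply: (squeeze_cvgr _ (cvg_cst 0) B2).
  apply: nearW => n; rewrite normr_ge0/=.
  have h (y : R) : `|y| = n.+1%:R -> `|F y| <= B * n.+1%:R^-1.
    by move=> yn; rewrite ler_pdivlMr// mulrC -yn -normrM.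
  rewrite (le_trans (ler_normB _ _))// -mulrA mulr_natl mulr2n lerD//.
    by apply: h; rewrite ger0_norm.
  by apply: h; rewrite normrN ger0_norm.
move: int_f_; under eq_cvg do rewrite F_.
move=> /fine_cvgP[_ /=] h.
exact: (cvg_unique _ h F0).
Unshelve. all: by end_near. Qed.
End VanishingIntegral.

(** E[N^n] for a standard normal N: the recursion is the integration by parts
E[N^(n+2)] = (n+1) E[N^n]. *)
Fixpoint normal_moment (R : realType) (n : nat) : R :=
  match n with
  | 0 => 1
  | 1 => 0
  | n'.+2 => n'.+1%:R * normal_moment R n'
  end.

Section NormalMoments.
Context {R : realType}.
Variable s : R.
Hypothesis s0 : 0 < s.
Let sN0 : s != 0. Proof. by rewrite gt_eqF. Qed.
Local Notation pdf := (normal_pdf 0 s).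

Lemma normal_pdf0E : pdf = fun x => normal_peak s * expR (- x ^+ 2 / (s ^+ 2 *+ 2)).
Proof.
by rewrite normal_pdfE//; apply/funext => x; rewrite /normal_fun subr0.
Qed.

Lemma has_mean_normal_prob (f : R -> R) m : measurable_fun setT f ->
  has_mean (@lebesgue_measure R) (fun x => f x * pdf x) m ->
  has_mean (normal_prob 0 s) f m.
Proof.
move=> mf hf.
have ge0 (g : R -> R) p : measurable_fun setT g -> (forall x, 0 <= g x) ->
    has_mean (@lebesgue_measure R) (fun x => g x * pdf x) p ->
    has_mean (normal_prob 0 s) g p.
  move=> mg g0 [_ eg]; apply: ge0_has_mean => //.
  rewrite -eg; apply: (@ge0_integral_density _ _ _ _ _ lebesgue_measure
    (normal_prob 0 s) id (normal_pdf 0 s)) => //.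
  - exact: measurable_normal_pdf.
  - exact: normal_pdf_ge0.
have [m1 [m2 [h1 h2 e]]] := has_mean_posneg hf.
have hp : has_mean (normal_prob 0 s) (fun x => Num.max (f x) 0) m1.
  apply: ge0; first exact: measurable_maxr.
    by move=> x; rewrite le_max lexx orbT.
  suff -> : (fun x => Num.max (f x) 0 * pdf x) =
    (fun x => Num.max (f x * pdf x) 0) by [].
  by apply/funext => x; rewrite maxr_pMl ?normal_pdf_ge0// mul0r.
have hn : has_mean (normal_prob 0 s) (fun x => Num.max (- f x) 0) m2.
  apply: ge0; first by apply: measurable_maxr => //; exact: measurableT_comp.
    by move=> x; rewrite le_max lexx orbT.
  suff -> : (fun x => Num.max (- f x) 0 * pdf x) =
    (fun x => Num.max (- (f x * pdf x)) 0) by [].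
  by apply/funext => x; rewrite maxr_pMl ?normal_pdf_ge0// mul0r mulNr.
have -> : f = fun x => Num.max (f x) 0 + (-1) * Num.max (- f x) 0.
  by apply/funext => x; rewrite mulN1r -maxr_posneg.
by rewrite e -[X in _ - X]mul1r -mulNr; apply: has_meanD => //; exact: has_meanZ.
Qed.

Lemma pow_le_expR (k : nat) : exists2 C, 0 <= C &
  forall x : R, `|x| ^+ k <= C * expR (x ^+ 2 / (s ^+ 2 *+ 4)).
Proof.
case: k => [|k].
  exists 1 => // x; rewrite expr0 mul1r -expR0 ler_expR divr_ge0 ?sqr_ge0//.
  by rewrite pmulrn_lge0// sqr_ge0.
pose q : R := s ^+ 2 *+ 4.
have q0 : 0 < q by rewrite pmulrn_lgt0// exprn_gt0.
exists (1 + q ^+ k.+1 * (k.+1)`!%:R).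
  by rewrite addr_ge0// mulr_ge0// exprn_ge0// ltW.
move=> x; set y := x ^+ 2 / q.
have y0 : 0 <= y by rewrite divr_ge0 ?sqr_ge0// ltW.
have h1 : 1 <= expR y by rewrite -expR0 ler_expR.
have h2 : y ^+ k.+1 <= (k.+1)`!%:R * expR y.
  rewrite mulrC -ler_pdivrMr ?ltr0n ?fact_gt0//.
  by rewrite (le_trans _ (expR_ge1Dxn k y0))// lerDr.
have h3 : `|x| ^+ k.+1 <= 1 + (x ^+ 2) ^+ k.+1.
  have [x1|x1] := leP `|x| 1.
    rewrite (le_trans (exprn_ile1 _ _ _))// lerDl exprn_ge0// sqr_ge0//.
  rewrite -real_normK ?num_real// -exprM mulnC exprM.
  rewrite ler_wpDl// ler_eXnr// exprn_ege1// ltW//.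
rewrite (le_trans h3)// mulrDl mul1r lerD//.
have -> : x ^+ 2 = q * y by rewrite /y mulrCA divff ?mulr1// gt_eqF.
by rewrite exprMn -mulrA ler_wpM2l// exprn_ge0// ltW.
Qed.

(** Half of the Gaussian exponent absorbs the power; what is left is, up to a
constant, the normal density of standard deviation sqrt 2 s. *)
Lemma pow_pdf_le (k : nat) : exists2 C, 0 <= C &
  forall x : R, `|x ^+ k * pdf x| <= C * expR (- x ^+ 2 / (s ^+ 2 *+ 4)).
Proof.
have [C C0 hC] := pow_le_expR k.
exists (C * normal_peak s) => [|x]; first by rewrite mulr_ge0// normal_peak_ge0.
rewrite normrM normrX [`|pdf x|]ger0_norm ?normal_pdf_ge0// normal_pdf0E.
rewrite mulrCA [C * _]mulrC -mulrA ler_wpM2l ?normal_peak_ge0//.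
have -> : expR (- x ^+ 2 / (s ^+ 2 *+ 2)) =
    expR (- x ^+ 2 / (s ^+ 2 *+ 4)) * expR (- x ^+ 2 / (s ^+ 2 *+ 4)).
  by rewrite -expRD; congr expR; field.
rewrite mulrA ler_wpM2r ?expR_ge0// -ler_pdivlMr ?expR_gt0//.
by rewrite -expRN mulNr opprK.
Qed.

Lemma measurable_pow_pdf k : measurable_fun setT (fun x : R => x ^+ k * pdf x).
Proof. by apply: measurable_funM; [|exact: measurable_normal_pdf]. Qed.

Lemma pow_pdf_mean (k : nat) : exists m,
  has_mean (@lebesgue_measure R) (fun x => x ^+ k * pdf x) m.
Proof.
have [C C0 hC] := pow_pdf_le k.
pose s' := Num.sqrt 2 * s.
have s'0 : s' != 0 by rewrite mulf_neq0// gt_eqF// sqrtr_gt0.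
have hs' : has_mean (@lebesgue_measure R) (normal_pdf 0 s') 1.
  by split; [exact: integrable_normal_pdf|exact: integral_normal_pdf].
have h := has_meanZ (C / normal_peak s') hs'.
suff hle : forall x, `|x ^+ k * pdf x| <= C / normal_peak s' * normal_pdf 0 s' x.
  have [m' hm _] := @has_mean_norm_le _ _ _ lebesgue_measure _ _ _ (measurable_pow_pdf k) hle h.
  by exists m'.
move=> x; apply: (le_trans (hC x)).
  rewrite normal_pdfE// /normal_fun subr0 mulrA divfK; last first.
    by rewrite gt_eqF// normal_peak_gt0.
  rewrite ler_wpM2l// ler_expR exprMn sqr_sqrtr// mulr_natl.
  by rewrite -mulrnA.
Qed.

Lemma pow_pdf_derive k (x : R) : is_derive x 1 (fun x : R => x ^+ k * pdf x)
  (k%:R * (x ^+ k.-1 * pdf x) - s ^- 2 * (x ^+ k.+1 * pdf x)).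
Proof.
have dp : is_derive x 1 pdf (- (x / s ^+ 2) * pdf x).
  rewrite normal_pdf0E.
  have -> : (fun x : R => normal_peak s * expR (- x ^+ 2 / (s ^+ 2 *+ 2))) =
    (fun x : R => normal_peak s *: expR ((- (s ^+ 2 *+ 2)^-1) *: x ^+ 2)).
    by apply/funext => y; rewrite /GRing.scale/=; congr (_ * expR _); ring.
  apply: is_derive_eq; rewrite /GRing.scale/=.
  rewrite (_ : - x ^+ 2 / _ = - (s ^+ 2 *+ 2)^-1 * x ^+ 2); last by ring.
  by field.
have dk : is_derive x 1 (fun y : R => y ^+ k) (k%:R * x ^+ k.-1).
  by apply: DeriveDef; [exact: exprn_derivable|rewrite exp_derive /GRing.scale/= mulr1].
apply: (is_derive_eq (is_deriveM dk dp)); rewrite /GRing.scale/= [x ^+ k.+1]exprS.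
by field.
Qed.

(** Integration by parts, in the form: the derivative of x^k pdf(x) has integral
zero. *)
Lemma pow_pdf_rec k m m' :
  has_mean (@lebesgue_measure R) (fun x => x ^+ k.-1 * pdf x) m ->
  has_mean (@lebesgue_measure R) (fun x => x ^+ k.+1 * pdf x) m' ->
  m' = s ^+ 2 * k%:R * m.
Proof.
move=> hm hm'.
have [C C0 hC] := pow_pdf_le k.+1.
have cp n : continuous (fun x : R => x ^+ n * pdf x).
  move=> x; apply: differentiable_continuous; apply/derivable1_diffP.
  by have [] := pow_pdf_derive n x.
have := has_meanD (has_meanZ k%:R hm) (has_meanZ (- s ^- 2) hm').
move/(integral_derivative_eq0 (F := fun x : R => x ^+ k * pdf x) (B := C)).
have h0 : k%:R * m - s ^- 2 * m' = 0 -> m' = s ^+ 2 * k%:R * m.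
  by move/eqP; rewrite subr_eq0 -mulrA => /eqP ->; rewrite mulrA divff ?mul1r ?expf_neq0.
move=> h; apply: h0; rewrite -mulNr; apply: h.
- by move=> x; have := pow_pdf_derive k x; rewrite mulNr.
- by move=> x; apply: cvgD; apply: cvgMr; exact: cp.
- move=> x; rewrite mulrA -exprS (le_trans (hC x))// ler_piMr// -expR0 ler_expR.
  by rewrite mulNr oppr_le0 divr_ge0 ?sqr_ge0// pmulrn_lge0// sqr_ge0.
Qed.

Lemma has_mean_normal_pow n :
  has_mean (normal_prob 0 s) (fun x => x ^+ n) (s ^+ n * normal_moment R n).
Proof.
apply: has_mean_normal_prob; first exact: measurable_funX.
have [m0 h0] := pow_pdf_mean 0; have [m1 h1] := pow_pdf_mean 1.
have e0 : m0 = 1.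
  have [_ e1] := h0; apply: EFin_inj; rewrite -e1.
  rewrite -(integral_normal_pdf 0 s); apply: eq_integral => x _.
  by rewrite expr0 mul1r.
have e1 : m1 = 0 by rewrite (pow_pdf_rec (k := 0) h0 h1) mulr0 mul0r.
have [//] : has_mean (@lebesgue_measure R) (fun x => x ^+ n * pdf x)
   (s ^+ n * normal_moment R n) /\
   has_mean (@lebesgue_measure R) (fun x => x ^+ n.+1 * pdf x)
   (s ^+ n.+1 * normal_moment R n.+1).
elim: n => [|n [IH0 IH1]].
  by rewrite /= expr0 !mulr1 mulr0; move: h0 h1; rewrite e0 e1.
split => //.
have [m hm] := pow_pdf_mean n.+2.
rewrite [_ * _](_ : _ = m)//; have := pow_pdf_rec (k := n.+1) IH0 hm => ->.
by rewrite /= -[in LHS](add2n n) exprD; ring.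
Qed.

End NormalMoments.

(** * Expectation of a product of independent variables *)

Section Independence.
Context {R : realType} {d d' : measure_display} {Omega : measurableType d}.
Context {E : measurableType d'}.
Variables (P : probability Omega R) (nu : probability E R).
Variables (I : finType) (X : I -> Omega -> E).
Hypothesis mX : forall i, measurable_fun setT (X i).
Hypothesis indepX : forall B : I -> set E, (forall i, measurable (B i)) ->
  (P [set omega | forall i, B i (X i omega)] = \prod_i nu (B i))%E.

(** Independence is given on events, so the identity starts from indicators; the
indicators are then replaced by the functions f i one index at a time, the
other factors being frozen in the density V of [ge0_integral_density]. *)
Lemma ge0_has_mean_prod (f : I -> E -> R) (m : I -> R) :
  (forall i y, 0 <= f i y) -> (forall i, has_mean nu (f i) (m i)) ->
  has_mean P (fun w => \prod_i f i (X i w)) (\prod_i m i).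
Proof.
move=> f0 hf; move: f m f0 hf.
have mfX (f : I -> E -> R) (m : I -> R) (p : pred I) :
    (forall i, has_mean nu (f i) (m i)) ->
    measurable_fun setT (fun w => \prod_(i | p i) f i (X i w)).
  move=> h; under eq_fun do rewrite big_mkcond.
  apply: measurable_prod => i _; case: (p i) => //.
  by apply: measurableT_comp => //; exact: has_mean_measurable (h i).
move=> f m f0 hf.
(* s lists the indices whose function is no longer an indicator. *)
suff main (s : seq I) : forall f m,
    (forall i, i \notin s -> exists2 B, measurable B & f i = \1_B) ->
    (forall i y, 0 <= f i y) -> (forall i, has_mean nu (f i) (m i)) ->
    has_mean P (fun w => \prod_i f i (X i w)) (\prod_i m i).
  by apply: (main (enum I)) => // i; rewrite mem_enum.
clear f m f0 hf; elim: s => [f m fB f0 hf|i s IH f m fB f0 hf].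
  have {fB} /choice[B fB] : forall i, exists B, measurable B /\ f i = \1_B.
    by move=> i; have [B mB e] := fB i isT; exists B.
  have mB i : measurable (B i) by have [] := fB i.
  have mA : measurable [set w | forall i, B i (X i w)].
    have -> : [set w | forall i, B i (X i w)] = \bigcap_(i in setT) (X i @^-1` B i).
      by apply/seteqP; split=> w h i => [_|]; exact: h.
    apply: fin_bigcap_measurable => // i _.
    by rewrite -[X in measurable X]setTI; exact: mX.
  apply: ge0_has_mean.
  - exact: mfX hf.
  - by move=> w; rewrite prodr_ge0.
  - transitivity (\int[P]_w (\1_[set w | forall i, B i (X i w)] w)%:E)%E.
      apply: eq_integral => w _; congr (_%:E); rewrite indicE.
      under eq_bigr do rewrite (fB _).2 indicE.
      have [h|h] := pselect (forall i, B i (X i w)).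
        by rewrite mem_set// big1// => i _; rewrite mem_set.
      have /existsNP[i hi] := h; have iN := memNset hi.
      by rewrite memNset// (bigD1 i)//= iN mul0r.
    rewrite integral_indic// setIT.
    transitivity (\prod_i nu (B i))%E; first exact: indepX.
    rewrite -prodEFin.
    apply: eq_bigr => i _; have [_ <-] := hf i; rewrite (fB i).2.
    by rewrite integral_indic// setIT.
pose V w := \prod_(j | j != i) f j (X j w).
pose c := \prod_(j | j != i) m j.
have m0 j : 0 <= m j by apply: has_mean_ge0 (hf j).
have c0 : 0 <= c by rewrite prodr_ge0.
have V0 w : 0 <= V w by rewrite prodr_ge0.
have mV : measurable_fun setT V by exact: mfX hf.
have dens A : measurable A ->
    (\int[P]_(w in X i @^-1` A) (V w)%:E = mscale (NngNum c0) nu A)%E.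
  move=> mA.
  pose f' j := if j == i then \1_A else f j.
  pose m' j := if j == i then fine (nu A) else m j.
  have [] := IH f' m'.
  - move=> j; rewrite /f'; have [->|ji] := eqVneq j i; first by exists A.
    by move=> js; apply: fB; rewrite inE negb_or ji.
  - by move=> j y; rewrite /f'; case: ifP.
  - move=> j; rewrite /f' /m'; case: ifP => // _.
    apply: ge0_has_mean => //.
    by rewrite integral_indic// setIT fineK// fin_num_measure.
  move=> _; rewrite [X in _ = X%:E](bigD1 i)//= {1}/m' eqxx.
  rewrite (eq_bigr m); last by move=> j ji; rewrite /m' (negbTE ji).
  rewrite EFinM fineK ?fin_num_measure// muleC => e.
  transitivity (c%:E * nu A)%E => //; rewrite -e.
  rewrite [LHS]integral_mkcond/=; apply: eq_integral => w _.
  rewrite epatch_indic /= (bigD1 i)//= {1}/f' eqxx mulrC EFinM.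
  congr (_%:E * _)%E; apply: eq_bigr => j ji.
  by rewrite /f' (negbTE ji).
apply: ge0_has_mean.
- exact: mfX hf.
- by move=> w; rewrite prodr_ge0.
transitivity (\int[P]_w (f i (X i w) * V w)%:E)%E.
  by apply: eq_integral => w _; rewrite (bigD1 i).
rewrite -(ge0_integral_density (mX i) mV V0 dens) => //; last first.
  exact: has_mean_measurable (hf i).
rewrite ge0_integral_mscale//=; last 2 first.
- by apply/measurable_EFinP; exact: has_mean_measurable (hf i).
- by move=> y _; rewrite lee_fin.
have [_ ->] := hf i.
by rewrite [X in _ = X%:E](bigD1 i)//= mulrC.
Qed.

(** The product of the differences f^+ - f^- is expanded into a signed sum of
products of nonnegative functions. *)
Lemma has_mean_prod (f : I -> E -> R) (m : I -> R) :
  (forall i, has_mean nu (f i) (m i)) ->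
  has_mean P (fun w => \prod_i f i (X i w)) (\prod_i m i).
Proof.
move=> hf.
pose F i (b : bool) y := if b then Num.max (f i y) 0 else Num.max (- f i y) 0.
have /choice[M hM] : forall i, exists M : bool -> R,
    (forall b, has_mean nu (F i b) (M b)) /\ m i = M true - M false.
  move=> i; have [m1 [m2 [h1 h2 e]]] := has_mean_posneg (hf i).
  by exists (fun b => if b then m1 else m2); split=> // -[].
pose e (b : bool) : R := if b then 1 else -1.
have eF i y : f i y = \sum_(b : bool) e b * F i b y.
  by rewrite big_bool/= mul1r mulN1r -maxr_posneg.
have -> : (fun w => \prod_i f i (X i w)) = (fun w =>
    \sum_(g : {ffun I -> bool}) (\prod_i e (g i)) * \prod_i F i (g i) (X i w)).
  apply/funext => w; under eq_bigr do rewrite eF.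
  rewrite bigA_distr_bigA; apply: eq_bigr => g _.
  by rewrite big_split.
have -> : \prod_i m i =
    \sum_(g : {ffun I -> bool}) (\prod_i e (g i)) * \prod_i M i (g i).
  have em i : m i = \sum_(b : bool) e b * M i b.
    by rewrite (hM i).2 big_bool/= mul1r mulN1r.
  under eq_bigr do rewrite em.
  by rewrite bigA_distr_bigA; apply: eq_bigr => g _; rewrite big_split.
apply: has_mean_sum => g; apply: has_meanZ; 
apply: (ge0_has_mean_prod (f := fun i => F i (g i)) (m := fun i => M i (g i))).
  by move=> i y; rewrite /F; case: ifP => _; rewrite le_max lexx orbT.
by move=> i; exact: (hM i).1.
Qed.
End Independence.

(** * Gaussian moments of monomials times powers of a linear form *)

Section GaussianPolynomials.
Context {R : realType} {n : nat}.
Implicit Types (b : 'I_n -> nat) (u : 'cV[R]_n) (z : 'I_n -> R).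

Definition incr_at b (l : 'I_n) : 'I_n -> nat := fun i => (b i + (i == l))%N.
Definition decr_at b (l : 'I_n) : 'I_n -> nat := fun i => (b i - (i == l))%N.
Definition null_index : 'I_n -> nat := fun=> 0%N.

Lemma incr_atC b i j : incr_at (incr_at b i) j = incr_at (incr_at b j) i.
Proof. by apply/funext => l; rewrite /incr_at addnAC. Qed.

Lemma monomial_incr_at z b l :
  \prod_i z i ^+ incr_at b l i = z l * \prod_i z i ^+ b i.
Proof.
rewrite (bigD1 l)//= [in RHS](bigD1 l)//= /incr_at eqxx addn1 exprS mulrA.
by congr (_ * _); apply: eq_bigr => i /negbTE ->; rewrite addn0.
Qed.

Lemma monomial_null z : \prod_i z i ^+ null_index i = 1.
Proof. by rewrite big1. Qed.

Lemma sum_incr_at b j : (\sum_i incr_at b j i = (\sum_i b i).+1)%N.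
Proof.
rewrite /incr_at big_split/= [X in (_ + X)%N](bigD1 j)//= eqxx.
by rewrite [X in (_ + (_ + X))%N]big1 ?addn0 ?addn1// => i /negbTE ->.
Qed.

(** E[prod_i Z_i^(b i) (u.Z)^m] for a standard Gaussian vector Z, computed by
expanding one factor u.Z at a time ([has_mean_mixed_moment]).  All the
identities below are thereby algebraic. *)
Fixpoint mixed_moment u (m : nat) b : R :=
  match m with
  | 0 => \prod_i normal_moment R (b i)
  | m'.+1 => \sum_l u l 0 * mixed_moment u m' (incr_at b l)
  end.

(** Differentiating x_l x^b in the variable x_i, where G (decr_at b i) stands for
the monomial of exponent b - e_i; the truncation of b - e_i at zero is harmless
because its coefficient b_i is then zero. *)
Lemma leibniz_incr_at (G : ('I_n -> nat) -> R) b i l :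
  (incr_at b l i)%:R * G (decr_at (incr_at b l) i) =
  (b i)%:R * G (incr_at (decr_at b i) l) + (i == l)%:R * G b.
Proof.
have [<-|il] := eqVneq i l.
  have -> : decr_at (incr_at b i) i = b.
    by apply/funext => j; rewrite /decr_at /incr_at addnK.
  rewrite {1}/incr_at eqxx natrD mulrDl; congr (_ + _).
  have [->|bi] := posnP (b i); first by rewrite !mul0r.
  congr (_ * G _); apply/funext => j; rewrite /incr_at /decr_at.
  by case: eqVneq => [->|_]; rewrite ?subn0 ?addn0// subnK.
rewrite mul0r addr0 {1}/incr_at (negbTE il) addn0; congr (_ * G _).
apply/funext => j; rewrite /incr_at /decr_at; case: (eqVneq j i) => [->|_].
  by rewrite (negbTE il) !addn0.
by rewrite !subn0.
Qed.

Lemma normal_moment_rec m : normal_moment R m.+1 = m%:R * normal_moment R m.-1.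
Proof. by case: m => [|m] //=; rewrite mul0r. Qed.

(** Gaussian integration by parts E[Z_i F(Z)] = E[(d_i F)(Z)] for
F(z) = z^b (u.z)^m. *)
Lemma mixed_moment_stein u m b i : mixed_moment u m (incr_at b i) =
  (b i)%:R * mixed_moment u m (decr_at b i) + m%:R * u i 0 * mixed_moment u m.-1 b.
Proof.
elim: m b => [|m IH] b.
  rewrite !mul0r addr0 /= (bigD1 i)//= [in RHS](bigD1 i)//= mulrA.
  rewrite /incr_at /decr_at eqxx addn1 subn1 normal_moment_rec; congr (_ * _).
  by apply: eq_bigr => j /negbTE ->; rewrite addn0 subn0.
rewrite [LHS]/=.
under eq_bigr => l _ do rewrite incr_atC IH leibniz_incr_at !mulrDr.
rewrite !big_split/= mulr_sumr -addrA; congr (_ + _).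
  by apply: eq_bigr => l _; rewrite mulrCA.
have -> : \sum_l u l 0 * ((i == l)%:R * mixed_moment u m b) = u i 0 * mixed_moment u m b.
  rewrite (bigD1 i)//= eqxx mul1r big1 ?addr0// => l li.
  by rewrite eq_sym (negbTE li) mul0r mulr0.
have -> : \sum_l u l 0 * (m%:R * u i 0 * mixed_moment u m.-1 (incr_at b l)) =
    m%:R * u i 0 * mixed_moment u m b.
  case: m {IH} => [|m]; first by rewrite !mul0r big1// => l _; rewrite !mul0r mulr0.
  by rewrite /= mulr_sumr; apply: eq_bigr => l _; rewrite mulrCA.
by rewrite -natr1 2!mulrDl mul1r addrC.
Qed.

(** A polynomial of odd degree in Z is made of monomials in which some coordinate
has an odd exponent. *)
Lemma mixed_moment_odd u m b : odd (\sum_i b i + m) -> mixed_moment u m b = 0.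
Proof.
elim: m b => [|m IH] b.
  rewrite addn0 /= => ob.
  have [i oi] : exists i, odd (b i).
    apply: contrapT => /forallNP h; move: ob; apply/negP.
    by elim/big_ind: _ => // [x y x0 y0|i _]; [rewrite oddD (negbTE x0)|exact/negP].
  have nodd k : odd k -> normal_moment R k = 0.
    suff : (odd k -> normal_moment R k = 0) /\ (odd k.+1 -> normal_moment R k.+1 = 0) by case.
    elim: k => [|k [IH1 IH2]]; first by split.
    by split => // /=; rewrite negbK => ok; rewrite IH1 ?mulr0.
  by rewrite (bigD1 i)//= nodd// mul0r.
move=> ob /=; rewrite big1// => l _; rewrite IH ?mulr0//.
by rewrite sum_incr_at addSnnS.
Qed.

(** A unit combination of the coordinates has the moments of a standard normal
variable. *)
Lemma mixed_moment_unit u m : \sum_l u l 0 ^+ 2 = 1 -> mixed_moment u m null_index = normal_moment R m.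
Proof.
move=> u1.
suff : mixed_moment u m null_index = normal_moment R m /\ mixed_moment u m.+1 null_index = normal_moment R m.+1 by case.
elim: m => [|m [IH1 IH2]].
  split; first by rewrite /= big1.
  by rewrite [RHS]/= mixed_moment_odd// big1.
split => //; rewrite [LHS]/=.
under eq_bigr => l _ do
  rewrite -/(mixed_moment u m.+1 (incr_at null_index l)) mixed_moment_stein mul0r add0r/= IH1.
under eq_bigr => l _ do rewrite mulrA mulrCA -expr2.
by rewrite -mulr_suml -mulr_sumr u1 mulr1.
Qed.

Lemma mixed_moment_unit2 u m i j : \sum_l u l 0 ^+ 2 = 1 ->
  mixed_moment u m.+2 (incr_at (incr_at null_index j) i) =
  normal_moment R m.+2 * ((i == j)%:R + m.+2%:R * u i 0 * u j 0).
Proof.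
move=> u1; rewrite mixed_moment_stein leibniz_incr_at mul0r add0r [m.+2.-1]/=.
rewrite (mixed_moment_stein u m.+1 null_index j) mul0r add0r [m.+1.-1]/=.
rewrite (mixed_moment_unit m.+2 u1) (mixed_moment_unit m u1) [normal_moment R m.+2]/=.
by ring.
Qed.

Lemma normal_moment_even_gt0 m : ~~ odd m -> 0 < normal_moment R m.
Proof.
suff : (~~ odd m -> 0 < normal_moment R m) /\ (~~ odd m.+1 -> 0 < normal_moment R m.+1).
  by case.
elim: m => [|m [IH1 IH2]]; first by split.
by split => // /=; rewrite negbK => om; rewrite mulr_gt0// IH1.
Qed.

Lemma gauss_momentE m : gauss_moment m = normal_moment R m.
Proof.
have [_ e] := has_mean_normal_pow (ltr01 : 0 < (1 : R)) m.
by rewrite /gauss_moment unlock e /= expr1n mul1r.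
Qed.

Section Vec.
Context {d : measure_display} {Omega : measurableType d}.
Variables (P : probability Omega R) (Z : 'I_n -> Omega -> R).
Hypothesis hZ : forall b : 'I_n -> nat,
  has_mean P (fun w => \prod_i Z i w ^+ b i) (\prod_i normal_moment R (b i)).

Lemma has_mean_mixed_moment u m b :
  has_mean P (fun w => (\prod_i Z i w ^+ b i) * (\sum_l u l 0 * Z l w) ^+ m)
    (mixed_moment u m b).
Proof.
elim: m b => [|m IH] b.
  by under eq_fun do rewrite expr0 mulr1; exact: hZ.
rewrite (_ : (fun w => _) = fun w => \sum_l u l 0 *
    ((\prod_i Z i w ^+ incr_at b l i) * (\sum_l u l 0 * Z l w) ^+ m)).
  by apply: has_mean_sum => l; apply: has_meanZ; exact: IH.
apply/funext => w; rewrite exprS mulrCA mulr_suml; apply: eq_bigr => l _.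
by rewrite (monomial_incr_at (fun i => Z i w)); ring.
Qed.

Context {l : nat}.
Variables (Sigma : 'M[R]_(n, l)) (k : nat).
Let zv w : 'cV[R]_n := \col_i Z i w.

Let ucol j : 'cV[R]_n := (norm2 (col j Sigma))^-1 *: col j Sigma.

Let norm2_sqr m (v : 'cV[R]_m) : norm2 v ^+ 2 = \sum_i v i 0 ^+ 2.
Proof. by rewrite sqr_sqrtr// sumr_ge0// => i _; exact: sqr_ge0. Qed.

Let ucol_unit j : norm2 (col j Sigma) != 0 -> \sum_l ucol j l 0 ^+ 2 = 1.
Proof.
move=> nj; under eq_bigr do rewrite mxE exprMn.
by rewrite -mulr_sumr -norm2_sqr -exprMn mulVf// expr1n.
Qed.

Lemma P2E w : P2 Sigma k (zv w) = \sum_j norm2 (col j Sigma) ^+ 2 *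
  (c_ k * (\sum_i ucol j i 0 * Z i w) ^+ (4 * k + 2) - d_ k).
Proof.
apply: eq_bigr => j _; case: eqP => [->|_]; first by rewrite expr0n mul0r.
congr (_ * (_ * _ ^+ _ - _)).
rewrite mxE mulr_suml; apply: eq_bigr => i _; rewrite !mxE.
by ring.
Qed.

Lemma has_mean_P2 b :
  has_mean P (fun w => (\prod_i Z i w ^+ b i) * P2 Sigma k (zv w))
   (\sum_j norm2 (col j Sigma) ^+ 2 *
     (c_ k * mixed_moment (ucol j) (4 * k + 2) b - d_ k * mixed_moment (ucol j) 0 b)).
Proof.
under eq_fun do rewrite P2E mulr_sumr.
apply: has_mean_sum => j.
rewrite (_ : (fun w => _) = fun w => norm2 (col j Sigma) ^+ 2 *
    (c_ k * ((\prod_i Z i w ^+ b i) * (\sum_i ucol j i 0 * Z i w) ^+ (4 * k + 2))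
     + (- d_ k) * ((\prod_i Z i w ^+ b i) * (\sum_i ucol j i 0 * Z i w) ^+ 0))).
  rewrite -mulNr.
  by apply: has_meanZ; apply: has_meanD; apply: has_meanZ; exact: has_mean_mixed_moment.
by apply/funext => w; rewrite expr0; ring.
Qed.

Let n4k : (4 * k + 2 = (4 * k).+2)%N. Proof. by rewrite addn2. Qed.
Let g_neq0 : normal_moment R (4 * k + 2) != 0.
Proof.
by rewrite gt_eqF// normal_moment_even_gt0// oddD oddM.
Qed.

Lemma has_mean_P2_0 : has_mean P (fun w => P2 Sigma k (zv w)) 0.
Proof.
have := has_mean_P2 null_index.
under eq_fun do rewrite (monomial_null (fun i => Z i _)) mul1r.
rewrite big1// => j _; have [->|nj] := eqVneq (norm2 (col j Sigma)) 0.
  by rewrite expr0n mul0r.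
rewrite !(mixed_moment_unit _ (ucol_unit nj)) /c_ /d_ gauss_momentE mulr1.
by rewrite invfM mulfVK// subrr mulr0.
Qed.

Lemma has_mean_P2_odd b : odd (\sum_i b i) ->
  has_mean P (fun w => (\prod_i Z i w ^+ b i) * P2 Sigma k (zv w)) 0.
Proof.
move=> ob; have := has_mean_P2 b; rewrite big1// => j _.
have h m : ~~ odd m -> mixed_moment (ucol j) m b = 0.
  by move=> om; rewrite mixed_moment_odd// oddD ob (negbTE om).
by rewrite (h 0%N)// h ?mulr0 ?subrr ?mulr0// oddD oddM.
Qed.

Lemma has_mean_P2_1 i : has_mean P (fun w => Z i w * P2 Sigma k (zv w)) 0.
Proof.
have := @has_mean_P2_odd (incr_at null_index i).
rewrite sum_incr_at big1// => /(_ isT).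
by under eq_fun do rewrite (monomial_incr_at (fun i => Z i _)) (monomial_null (fun i => Z i _)) mulr1.
Qed.

Lemma has_mean_P2_3 i j m :
  has_mean P (fun w => Z i w * Z j w * Z m w * P2 Sigma k (zv w)) 0.
Proof.
have := @has_mean_P2_odd (incr_at (incr_at (incr_at null_index m) j) i).
rewrite !sum_incr_at big1// => /(_ isT).
by under eq_fun do rewrite !(monomial_incr_at (fun i => Z i _)) (monomial_null (fun i => Z i _)) mulr1 !mulrA.
Qed.

(** For a unit column e the weight contributes
c_k E[N^p] (delta_ij + p e_i e_j) - d_k delta_ij with p = 4k+2; since
c_k E[N^p] = d_k = 1/p, this is e_i e_j. *)
Lemma has_mean_P2_2 i j :
  has_mean P (fun w => Z i w * Z j w * P2 Sigma k (zv w))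
    ((Sigma *m Sigma^T) i j).
Proof.
have := has_mean_P2 (incr_at (incr_at null_index j) i).
under eq_fun do rewrite !(monomial_incr_at (fun i => Z i _)) (monomial_null (fun i => Z i _)) mulr1.
rewrite [X in has_mean _ _ X -> _](_ : _ = (Sigma *m Sigma^T) i j)//.
rewrite mxE; apply: eq_bigr => m _; rewrite [in RHS]mxE.
have [nj|nj] := eqVneq (norm2 (col m Sigma)) 0.
  have : \sum_i (col m Sigma i 0) ^+ 2 = 0 by rewrite -norm2_sqr nj expr0n.
  move/psumr_eq0P => /(_ (fun i _ => sqr_ge0 _)) /(_ i isT) /eqP.
  by rewrite sqrf_eq0 mxE nj expr0n mul0r => /eqP ->; rewrite mul0r.
have u1 := ucol_unit nj.
rewrite [in c_ _ * mixed_moment _ _ _]n4k (mixed_moment_unit2 _ _ _ u1) -n4k.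
rewrite mixed_moment_stein leibniz_incr_at !mul0r addr0 add0r (mixed_moment_unit _ u1) mulr1.
rewrite /c_ /d_ gauss_momentE !mxE invfM.
have e : 4 * k%:R + 2 != 0 :> R by rewrite -natrM -natrD pnatr_eq0 n4k.
by field; rewrite e g_neq0 nj.
Qed.

End Vec.
End GaussianPolynomials.

(** * A fourth moment bound for the weighted remainder *)

Section FourthMoment.
Context {R : realType} {n : nat}.

(** The sum is at most n times its largest term. *)
Lemma sum_pow_le (z : 'I_n -> R) m : (0 < m)%N ->
  (\sum_i `|z i|) ^+ m <= n%:R ^+ m * \sum_i `|z i| ^+ m.
Proof.
move=> m0; case: n z => [|n'] z.
  by rewrite !big_ord0 expr0n mulr0 eqn0Ngt m0.
have [i _ hi] := @Order.TotalTheory.arg_maxP _ _ _ ord0 xpredT (fun i => `|z i|) isT.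
have le1 : \sum_i `|z i| <= n'.+1%:R * `|z i|.
  apply: (le_trans (ler_sum _ (fun j _ => hi j isT))).
  by rewrite sumr_const card_ord mulr_natl.
apply: (le_trans (lerXn2r m _ _ le1)); rewrite ?nnegrE ?mulr_ge0 ?sumr_ge0//.
rewrite exprMn ler_wpM2l ?exprn_ge0//.
by rewrite (bigD1 i)//= lerDl sumr_ge0// => j _; rewrite exprn_ge0.
Qed.

(** The part of the bound on E[(sum_i |Z_i|)^4 |P2(Z)|] that depends on n and k
only.  The exponents 4k+6 and 4 come from multiplying the two terms of P2 by
the fourth power. *)
Definition P2_moment_bound (k : nat) : R :=
  c_ k * n%:R ^+ (4 * k + 6) * (n%:R * normal_moment R (4 * k + 6)) +
  d_ k * n%:R ^+ 4 * (n%:R * normal_moment R 4).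

Context {d : measure_display} {Omega : measurableType d}.
Variables (P : probability Omega R) (Z : 'I_n -> Omega -> R).
Hypothesis hZ : forall b : 'I_n -> nat,
  has_mean P (fun w => \prod_i Z i w ^+ b i) (\prod_i normal_moment R (b i)).
Context {l : nat}.
Variables (Sigma : 'M[R]_(n, l)) (k : nat).
Let zv w : 'cV[R]_n := \col_i Z i w.

Lemma c__ge0 : 0 <= c_ k :> R.
Proof.
rewrite /c_ gauss_momentE invr_ge0 mulr_ge0// ltW// normal_moment_even_gt0//.
by rewrite oddD oddM.
Qed.

Lemma P2_abs_le w : `|P2 Sigma k (zv w)| <= \tr (Sigma *m Sigma^T) *
  (c_ k * (\sum_i `|Z i w|) ^+ (4 * k + 2) + d_ k).
Proof.
have -> : \tr (Sigma *m Sigma^T) = \sum_j norm2 (col j Sigma) ^+ 2.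
  rewrite /mxtrace; under eq_bigr do rewrite mxE.
  rewrite exchange_big/=; apply: eq_bigr => j _.
  rewrite sqr_sqrtr ?sumr_ge0// => [|i _]; last exact: sqr_ge0.
  by apply: eq_bigr => i _; rewrite !mxE expr2.
rewrite P2E mulr_suml (le_trans (ler_norm_sum _ _ _))//.
apply: ler_sum => j _; rewrite normrM ger0_norm ?sqr_ge0//.
have [->|nj] := eqVneq (norm2 (col j Sigma)) 0; first by rewrite expr0n !mul0r.
rewrite ler_wpM2l ?sqr_ge0// (le_trans (ler_normB _ _))// lerD//; last first.
  by rewrite ger0_norm// invr_ge0.
rewrite normrM ger0_norm ?c__ge0// ler_wpM2l ?c__ge0//.
rewrite normrX lerXn2r ?nnegrE ?sumr_ge0//.
rewrite (le_trans (ler_norm_sum _ _ _))// ler_sum// => i _.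
rewrite normrM ler_piMl//.
have n0 : 0 < norm2 (col j Sigma) by rewrite lt_neqAle eq_sym nj sqrtr_ge0.
rewrite mxE normrM normfV (ger0_norm (ltW n0)).
rewrite mulrC ler_pdivrMr// mul1r -sqrtr_sqr ler_wsqrtr//.
by rewrite (bigD1 i)//= lerDl sumr_ge0// => i' _; exact: sqr_ge0.
Qed.

Lemma has_mean_pow i m : has_mean P (fun w => Z i w ^+ m) (normal_moment R m).
Proof.
have := hZ (fun j => if j == i then m else 0%N).
rewrite [X in has_mean _ _ X](bigD1 i)//= eqxx [X in _ * X]big1 ?mulr1; last first.
  by move=> j /negbTE ->.
congr (has_mean _ _ _); apply/funext => w; rewrite (bigD1 i)//= eqxx big1 ?mulr1//.
by move=> j /negbTE ->; rewrite expr0.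
Qed.

(** All the powers of |Z_i| that occur are even, so their moments are those of
[normal_moment].  The trace is the sum of the squared norms of the columns of
Sigma. *)
Lemma P2_fourth_moment : exists2 G, (forall w,
    (\sum_i `|Z i w|) ^+ 4 * `|P2 Sigma k (zv w)| <= G w) &
  has_mean P G (\tr (Sigma *m Sigma^T) * P2_moment_bound k).
Proof.
set B := \tr _.
have B0 : 0 <= B.
  by rewrite sumr_ge0// => i _; rewrite mxE sumr_ge0// => j _; rewrite mxE sqr_ge0.
pose S m w := \sum_i Z i w ^+ m.
have hS m : has_mean P (S m) (n%:R * normal_moment R m).
  rewrite mulr_natl -[X in _ *+ X]card_ord -sumr_const.
  by apply: has_mean_sum => i; exact: has_mean_pow.
exists (fun w => B * (c_ k * n%:R ^+ (4 * k + 6) * S (4 * k + 6)%N w +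
   d_ k * n%:R ^+ 4 * S 4 w)); last first.
  by apply: has_meanZ; apply: has_meanD; apply: has_meanZ.
move=> w; set N := \sum_i `|Z i w|.
have N0 : 0 <= N by rewrite sumr_ge0.
have SE m : ~~ odd m -> (0 < m)%N -> N ^+ m <= n%:R ^+ m * S m w.
  move=> em m0; apply: (le_trans (sum_pow_le _ m0)).
  rewrite ler_wpM2l ?exprn_ge0// ler_sum// => i _.
  by rewrite -normrX ger0_norm// real_exprn_even_ge0 ?num_real.
rewrite (le_trans (ler_wpM2l _ (P2_abs_le w))) ?exprn_ge0//.
rewrite mulrCA ler_wpM2l// mulrDr lerD//.
  rewrite mulrCA -exprD -mulrA ler_wpM2l ?c__ge0//.
  rewrite (_ : 4 + (4 * k + 2) = 4 * k + 6)%N; last by rewrite addnCA.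
  by apply: SE; rewrite ?addn_gt0 ?orbT// oddD oddM.
by rewrite mulrC -mulrA ler_wpM2l ?invr_ge0// SE.
Qed.
End FourthMoment.

(** * The increment of the Brownian motion *)

Section BrownianIncrement.
Context {R : realType} {n : nat} {d : measure_display}.
Context {Omega : measurableType d}.
Variables (P : probability Omega R) (W : R -> Omega -> 'cV[R]_n).
Hypothesis bW : brownian_motion P W.
Variables (t h : R).
Hypotheses (t0 : 0 <= t) (h0 : 0 < h).

Lemma measurable_increment i :
  measurable_fun setT (fun w => increment W t (t + h) w i 0).
Proof.
have [_ mW _ _ _] := bW.
under eq_fun do rewrite !mxE.
by apply: measurable_funB; apply: mW; rewrite // addr_ge0// ltW.
Qed.

Lemma has_mean_increment (b : 'I_n -> nat) :
  has_mean P (fun w => \prod_i ((Num.sqrt h)^-1 * increment W t (t + h) w i 0) ^+ b i)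
    (\prod_i normal_moment R (b i)).
Proof.
have s0 : 0 < Num.sqrt h by rewrite sqrtr_gt0.
have indep (B : 'I_n -> set R) : (forall i, measurable (B i)) ->
    (P [set w | forall i, B i (increment W t (t + h) w i 0%R)] =
     \prod_i normal_prob 0%R (Num.sqrt h) (B i))%E.
  move=> mB; have [_ _ law ind _] := bW.
  pose tm (j : nat) := t + j%:R * h.
  have tm1 : tm 1%N = t + h by rewrite /tm mul1r.
  have tm0 : tm 0%N = t by rewrite /tm mul0r addr0.
  have := ind 1%N tm (fun=> B).
  rewrite {1}tm0 => /(_ t0) H.
  have {}H := H (fun j => _) (fun _ => mB).
  transitivity (P [set w | forall (j : 'I_1) i, B i (increment W (tm j) (tm j.+1) w i 0)])%R.
    congr (P _); apply/seteqP; split => w /= Hw.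
      by move=> j i; rewrite ord1 /= tm0 tm1.
    by move=> i; have := Hw ord0 i; rewrite /= tm0 tm1.
  rewrite H => [|j]; last by rewrite /tm ltrD2l ltr_pM2r// ltr_nat.
  have tth : t < t + h by rewrite ltrDl.
  rewrite big_ord1; apply: eq_bigr => i _.
  rewrite tm0 tm1 (law t (t + h) i (B i) t0 tth (mB i)).
  by rewrite [t + h]addrC addrK.
have := @has_mean_prod _ _ _ _ _ P (normal_prob 0 (Num.sqrt h)) _ _
  measurable_increment indep _ _ (fun i => has_mean_normal_pow s0 (b i)).
move/(has_meanZ (\prod_i (Num.sqrt h)^-1 ^+ b i)).
rewrite [X in has_mean _ _ X -> _](_ : _ = \prod_i normal_moment R (b i)); last first.
  rewrite -big_split; apply: eq_bigr => i _ /=.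
  by rewrite mulrA -exprMn mulVf ?gt_eqF// expr1n mul1r.
congr (has_mean _ _ _); apply/funext => w; rewrite -big_split/=.
by apply: eq_bigr => i _; rewrite exprMn.
Qed.
End BrownianIncrement.

(** * Directional derivatives in a normed space *)

Section Directional.
Context {R : realType} {V : normedModType R}.
Implicit Types (u g G : V -> R) (x y e : V).

(** The derivative is required at every point, for the mean value theorem. *)
Definition dir_derivative u e g := forall x, is_derive x e u (g x).

Lemma is_derive_line u e x l :
  is_derive x e u l <-> is_derive (0 : R) 1 (fun r : R => u (x + r *: e)) l.
Proof.
have E : (fun h : R => h^-1 *: ((u \o shift x) (h *: e) - u x)) =
    (fun h : R => h^-1 *: (((fun r : R => u (x + r *: e)) \o shift 0) (h *: 1)
       - u (x + 0 *: e))).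
  by apply/funext => h /=; rewrite scale0r !addr0 [h *: 1]mulr1 [x + _]addrC.
by split => -[d1 d2]; split; move: d1 d2; rewrite /derivable /derive E.
Qed.

Lemma dir_derivative_line u e g x (r : R) : dir_derivative u e g ->
  is_derive r 1 (fun r : R => u (x + r *: e)) (g (x + r *: e)).
Proof.
move=> /(_ (x + r *: e)).
have E : (fun h : R => h^-1 *: ((u \o shift (x + r *: e)) (h *: e) - u (x + r *: e))) =
    (fun h : R => h^-1 *: (((fun r : R => u (x + r *: e)) \o shift r) (h *: 1)
       - u (x + r *: e))).
  apply/funext => h /=; congr (_ *: (u _ - _)).
  by rewrite scalerDl [h *: 1]mulr1 addrCA.
by move=> -[d1 d2]; split; move: d1 d2; rewrite /derivable /derive E.
Qed.

Lemma dir_derivative_MVT u e g x (r : R) : dir_derivative u e g ->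
  exists2 s : R, `|s| <= `|r| & u (x + r *: e) - u x = r * g (x + s *: e).
Proof.
move=> du.
pose f (r : R) := u (x + r *: e); pose df (r : R) := g (x + r *: e).
have hd (s : R) : is_derive s 1 f (df s) by exact: dir_derivative_line.
have cf A : {within A, continuous f}.
  apply: continuous_subspaceT => s; apply: differentiable_continuous.
  by apply/derivable1_diffP; have [] := hd s.
have f0 : u x = f 0 by rewrite /f scale0r addr0.
have [r0|r0] := leP 0 r.
  have [s + e1] := MVT_segment r0 (fun s _ => hd s) (cf _).
  rewrite in_itv/= => /andP[s0 sr]; exists s; first by rewrite !ger0_norm.
  by rewrite f0 -[u _]/(f r) e1 subr0 mulrC.
have [s + e1] := MVT_segment (ltW r0) (fun s _ => hd s) (cf _).
rewrite in_itv/= => /andP[rs s0]; exists s.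
  by rewrite !ler0_norm// ?lerN2// ltW.
by rewrite f0 -[u _]/(f r) -[LHS]opprB e1 sub0r mulrN opprK mulrC.
Qed.

Lemma dir_derivativeZ u e g (c : R) :
  dir_derivative u e g -> dir_derivative u (c *: e) (fun x => c * g x).
Proof.
move=> du x; apply/is_derive_line.
have -> : (fun r : R => u (x + r *: (c *: e))) =
    (fun r : R => u (x + r *: e)) \o (fun r : R => c *: r).
  by apply/funext => r /=; rewrite scalerA mulrC.
have h1 : is_derive (c *: (0 : R)) 1 (fun r : R => u (x + r *: e)) (g x).
  have := dir_derivative_line x (c *: 0) du.
  by rewrite scaler0 scale0r addr0.
have h2 : is_derive (0 : R) 1 (fun r : R => c *: r) c.
  by apply: is_derive_eq; rewrite [_ *: _]mulr1.
have := is_derive1_comp h1 h2; rewrite mulrC.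
done.
Qed.

(** The increment along y + e is an increment along e from x followed by one
along y from x + r e.  The mean value theorem turns the second into a value of
G at a point near x, and continuity of G concludes.  This is the step by which
continuous partial derivatives give all directional derivatives. *)
Lemma dir_derivativeD u y e G g : continuous G ->
  dir_derivative u y G -> dir_derivative u e g ->
  dir_derivative u (y + e) (fun x => G x + g x).
Proof.
move=> cG dy de x.
suff : (fun r : R => r^-1 *: ((u \o shift x) (r *: (y + e)) - u x)) @ 0^'
    --> G x + g x.
  move=> h; apply: DeriveDef; first by apply/cvg_ex; eexists; exact: h.
  exact: (cvg_lim (@Rhausdorff R) h).
have /choice[s hs] : forall r : R, exists s : R, `|s| <= `|r| /\
    u (x + r *: e + r *: y) - u (x + r *: e) = r * G (x + r *: e + s *: y).
  by move=> r; have [s s1 s2] := dir_derivative_MVT (x + r *: e) r dy; exists s.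
have h1 : (fun r : R => G (x + r *: e + s r *: y)) @ 0^' --> G x.
  apply/cvgrPdist_lt => /= eps eps0.
  have /cvgrPdist_lt/(_ _ eps0) := cG x.
  move=> /nbhs_normP[delta /= delta0 hdelta].
  have D0 : 0 < delta / (1 + `|e| + `|y|).
    by rewrite divr_gt0// -addrA ltr_wpDr// addr_ge0.
  near=> r; apply: hdelta; rewrite /ball_/=.
  rewrite -addrA opprD addrA subrr add0r normrN.
  rewrite (le_lt_trans (ler_normD _ _))// !normrZ.
  rewrite (@le_lt_trans _ _ (`|r| * (1 + `|e| + `|y|)))//.
    rewrite !mulrDr mulr1 -addrA ler_wpDl// lerD// ler_wpM2r//.
    by have [] := hs r.
  rewrite -ltr_pdivlMr; last by rewrite -addrA ltr_wpDr// addr_ge0.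
  near: r; apply: dnbhs0_lt; exact: D0.
have h2 : (fun r : R => r^-1 *: ((u \o shift x) (r *: e) - u x)) @ 0^' --> g x.
  by have [d1 <-] := de x; exact: d1.
apply: cvg_trans (cvgD h1 h2); apply: near_eq_cvg; near=> r.
have r0 : r != 0 by near: r; exact: nbhs_dnbhs_neq.
have [_ er] := hs r.
transitivity (G (x + r *: e + s r *: y) +
    r^-1 * (u (r *: e + x) - u x)); first by [].
have -> : G (x + r *: e + s r *: y) =
    r^-1 * (u (x + r *: e + r *: y) - u (x + r *: e)) by rewrite er mulKf.
rewrite -mulrDr -[RHS]/(r^-1 * _); congr (_ * _).
rewrite /= [r *: e + x]addrC subrKA; congr (u _ - _).
by rewrite scalerDr [RHS]addrC [r *: y + _]addrC addrA.
Unshelve. all: by end_near. Qed.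

Lemma dir_derivative0 u : dir_derivative u 0 (fun=> 0).
Proof. by move=> x; exact: is_derive0. Qed.

Lemma dir_derivative_sum (I : Type) (r : seq I) u (c : I -> R) (e : I -> V)
    (g : I -> V -> R) :
  (forall i, continuous (g i)) -> (forall i, dir_derivative u (e i) (g i)) ->
  dir_derivative u (\sum_(i <- r) c i *: e i)
    (fun x => \sum_(i <- r) c i * g i x).
Proof.
move=> cg dg; elim: r => [|i r IH].
  rewrite big_nil (_ : (fun x => _) = fun=> 0); last first.
    by apply/funext => x; rewrite big_nil.
  exact: dir_derivative0.
rewrite big_cons (_ : (fun x => _) =
    fun x => c i * g i x + \sum_(j <- r) c j * g j x); last first.
  by apply/funext => x; rewrite big_cons.
apply: dir_derivativeD IH.
- by move=> x; apply: cvgMr; exact: cg.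
- exact: dir_derivativeZ.
Qed.

(** The second difference of u over a parallelogram of sides r e and r f is, by
two applications of the mean value theorem, r^2 times a value of gef, and also
r^2 times a value of gfe, at points within O(r) of x. *)
Lemma mixed_derivativesC u e f ge gf gef gfe :
  dir_derivative u e ge -> dir_derivative u f gf ->
  dir_derivative ge f gef -> dir_derivative gf e gfe ->
  continuous gef -> continuous gfe -> gef =1 gfe.
Proof.
move=> de df def dfe cef cfe x; apply/eqP; rewrite -subr_eq0 -normr_le0.
apply/ler_addgt0Pr => eps eps0; rewrite add0r.
have eps20 : 0 < eps / 2 by rewrite divr_gt0.
have /cvgrPdist_lt/(_ _ eps20) := cef x; move=> /nbhs_normP[d1 /= d10 h1].
have /cvgrPdist_lt/(_ _ eps20) := cfe x; move=> /nbhs_normP[d2 /= d20 h2].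
(* The parallelogram lies in the balls of radius d1 and d2. *)
pose r := Num.min d1 d2 / 2 / (1 + `|e| + `|f|).
have D0 : 0 < 1 + `|e| + `|f| by rewrite -addrA ltr_wpDr// addr_ge0.
have m0 : 0 < Num.min d1 d2 by rewrite lt_min d10.
have r0 : 0 < r by rewrite !divr_gt0.
have small (s1 s2 : R) : `|s1| <= r -> `|s2| <= r ->
    `|x - (x + s1 *: e + s2 *: f)| < Num.min d1 d2.
  move=> hs1 hs2; rewrite -addrA opprD addrA subrr add0r normrN.
  rewrite (le_lt_trans (ler_normD _ _))// !normrZ.
  rewrite (@le_lt_trans _ _ (r * (1 + `|e| + `|f|)))//.
    rewrite !mulrDr mulr1 -addrA ler_wpDl ?(ltW r0)// lerD// ler_wpM2r//.
  by rewrite /r divfK ?gt_eqF// ltr_pdivrMr// ltr_pMr// ltr1n.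
pose D := u (x + r *: e + r *: f) - u (x + r *: e) - u (x + r *: f) + u x.
have E1 : exists s1 s2 : R, [/\ `|s1| <= r, `|s2| <= r &
    D = r * (r * gef (x + s1 *: e + s2 *: f))].
  pose U y := u (y + r *: f) - u y.
  have dU : dir_derivative U e (fun y => ge (y + r *: f) - ge y).
    move=> y; apply/is_derive_line; rewrite /U.
    have := dir_derivative_line (y + r *: f) 0 de.
    have := dir_derivative_line y 0 de.
    rewrite !scale0r !addr0 => k1 k2.
    have := is_deriveB k2 k1.
    congr (is_derive _ _ _ _); apply/funext => s; rewrite -[LHS]/(_ - _).
    by rewrite addrAC.
  have [s1 hs1 e1] := dir_derivative_MVT x r dU.
  have [s2 hs2 e2] := dir_derivative_MVT (x + s1 *: e) r def.
  rewrite (ger0_norm (ltW r0)) in hs1 hs2.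
  exists s1, s2; split => //; rewrite -e2 -e1 /U /D.
  by lra.
have E2 : exists s1 s2 : R, [/\ `|s1| <= r, `|s2| <= r &
    D = r * (r * gfe (x + s1 *: e + s2 *: f))].
  pose U y := u (y + r *: e) - u y.
  have dU : dir_derivative U f (fun y => gf (y + r *: e) - gf y).
    move=> y; apply/is_derive_line; rewrite /U.
    have := dir_derivative_line (y + r *: e) 0 df.
    have := dir_derivative_line y 0 df.
    rewrite !scale0r !addr0 => k1 k2.
    have := is_deriveB k2 k1.
    congr (is_derive _ _ _ _); apply/funext => s; rewrite -[LHS]/(_ - _).
    by rewrite addrAC.
  have [s2 hs2 e1] := dir_derivative_MVT x r dU.
  have [s1 hs1 e2] := dir_derivative_MVT (x + s2 *: f) r dfe.
  rewrite (ger0_norm (ltW r0)) in hs1 hs2.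
  exists s1, s2; split => //; rewrite [x + s1 *: e + _]addrAC -e2 -e1 /U /D.
  by rewrite [x + r *: f + _]addrAC; lra.
have [s1 [s2 [a1 a2 a3]]] := E1; have [t1 [t2 [b1 b2 b3]]] := E2.
have geq : gef (x + s1 *: e + s2 *: f) = gfe (x + t1 *: e + t2 *: f).
  by apply: (mulfI (lt0r_neq0 r0)); apply: (mulfI (lt0r_neq0 r0)); rewrite -a3.
have m1 : Num.min d1 d2 <= d1 by rewrite ge_min lexx.
have m2 : Num.min d1 d2 <= d2 by rewrite ge_min lexx orbT.
have k1 := h1 _ (lt_le_trans (small _ _ a1 a2) m1).
have k2 := h2 _ (lt_le_trans (small _ _ b1 b2) m2).
rewrite /= in k1 k2.
have -> : gef x - gfe x = (gef x - gef (x + s1 *: e + s2 *: f)) -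
   (gfe x - gfe (x + t1 *: e + t2 *: f)) by rewrite geq; lra.
by rewrite (le_trans (ler_normB _ _))// [leRHS]splitr lerD// ltW.
Qed.

End Directional.

(** * Taylor expansion *)

Section Taylor.
Context {R : realType}.

Lemma norm_increment_le (f df : R -> R) (B : R) :
  (forall r : R, is_derive r 1 f (df r)) ->
  (forall r, 0 <= r <= 1 -> `|df r| <= B) ->
  forall r, 0 <= r <= 1 -> `|f r - f 0| <= B.
Proof.
move=> hd hB r /andP[r0 r1].
have cf A : {within A, continuous f}.
  apply: continuous_subspaceT => s; apply: differentiable_continuous.
  by apply/derivable1_diffP; have [] := hd s.
have [s + ->] := MVT_segment r0 (fun s _ => hd s) (cf _).
rewrite in_itv/= => /andP[s0 sr]; rewrite subr0 normrM (ger0_norm r0).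
have hs : `|df s| <= B by apply: hB; rewrite s0 (le_trans sr).
by rewrite (le_trans _ hs)// ler_piMr.
Qed.

(** The mean value inequality on [0, 1] is applied four times, to each derivative
minus its Taylor polynomial at 0.  The factor 1/4! is given up. *)
Lemma taylor4 (f0 f1 f2 f3 f4 : R -> R) (B : R) :
  (forall r : R, is_derive r 1 f0 (f1 r)) ->
  (forall r : R, is_derive r 1 f1 (f2 r)) ->
  (forall r : R, is_derive r 1 f2 (f3 r)) ->
  (forall r : R, is_derive r 1 f3 (f4 r)) ->
  (forall r, 0 <= r <= 1 -> `|f4 r| <= B) ->
  `|f0 1 - (f0 0 + f1 0 + 2^-1 * f2 0 + 6^-1 * f3 0)| <= B.
Proof.
move=> d0 d1 d2 d3 hB.
pose g2 r := f2 r - f3 0 * r.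
pose g1 r := f1 r - (f2 0 * r + 2^-1 * f3 0 * r ^+ 2).
pose g0 r := f0 r - (f1 0 * r + 2^-1 * f2 0 * r ^+ 2 + 6^-1 * f3 0 * r ^+ 3).
have p (c r : R) n : is_derive r 1 (fun r : R => c * r ^+ n) (c * (n%:R * r ^+ n.-1)).
  have := is_deriveZ c (DeriveDef (@exprn_derivable R n r 1) (@exp_derive R n r 1)).
  by rewrite /GRing.scale/= mulr1.
have e3 r : 0 <= r <= 1 -> `|f3 r - f3 0| <= B by exact: norm_increment_le.
have dg2 (r : R) : is_derive r 1 g2 (f3 r - f3 0).
  have := is_deriveB (d2 r) (p (f3 0) r 1%N).
  by rewrite /= expr0 !mulr1; congr (is_derive _ _ _ _).
have e2 r : 0 <= r <= 1 -> `|g2 r - g2 0| <= B.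
  by exact: (norm_increment_le dg2 e3).
have dg1 (r : R) : is_derive r 1 g1 (g2 r - g2 0).
  have := is_deriveB (d1 r) (is_deriveD (p (f2 0) r 1%N) (p (2^-1 * f3 0) r 2%N)).
  by move=> H; apply: (is_derive_eq H); rewrite /g2 /=; field.
have e1 r : 0 <= r <= 1 -> `|g1 r - g1 0| <= B.
  by exact: (norm_increment_le dg1 e2).
have dg0 (r : R) : is_derive r 1 g0 (g1 r - g1 0).
  have := is_deriveB (d0 r) (is_deriveD (is_deriveD (p (f1 0) r 1%N)
    (p (2^-1 * f2 0) r 2%N)) (p (6^-1 * f3 0) r 3%N)).
  by move=> H; apply: (is_derive_eq H); rewrite /g1 /=; field.
have e0 r : 0 <= r <= 1 -> `|g0 r - g0 0| <= B.
  by exact: (norm_increment_le dg0 e1).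
have := e0 1; rewrite lexx ler01 => /(_ isT).
by congr (`|_| <= B); rewrite /g0; field.
Qed.
End Taylor.

(** * Iterated partial derivatives in space *)

Section Words.
Context {R : realType} {d : nat}.
Implicit Types (u : 'cV[R]_d -> R) (x y : 'cV[R]_d) (w : seq 'I_d).

Definition Dword w u : 'cV[R]_d -> R :=
  foldr (fun i (f : 'cV[R]_d -> R) x => 'D_(delta_mx i 0) f x) u w.

Definition smooth k u : Prop := forall w, (size w <= k)%N ->
  continuous (Dword w u) /\
  ((size w < k)%N -> forall i x, derivable (Dword w u) x (delta_mx i 0)).

Lemma smooth_dir k u w i : smooth k u -> (size w < k)%N ->
  dir_derivative (Dword w u) (delta_mx i 0) (Dword (i :: w) u).
Proof. by move=> su wk x; apply/derivableP; apply: (su w (ltnW wk)).2. Qed.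

Lemma Dword_swap k u w i j : smooth k u -> (size w + 2 <= k)%N ->
  Dword (i :: j :: w) u = Dword (j :: i :: w) u.
Proof.
rewrite addn2 => su wk.
apply/funext; apply: (@mixed_derivativesC _ _ (Dword w u) (delta_mx j 0) (delta_mx i 0)
  (Dword (j :: w) u) (Dword (i :: w) u)).
- exact: (smooth_dir j su (ltnW wk)).
- exact: (smooth_dir i su (ltnW wk)).
- exact: (@smooth_dir k u (j :: w) i su wk).
- exact: (@smooth_dir k u (i :: w) j su wk).
- exact: (su (i :: j :: w) wk).1.
- exact: (su (j :: i :: w) wk).1.
Qed.

Lemma Dword_move k u i w1 w2 : smooth k u -> (size (i :: w1 ++ w2) <= k)%N ->
  Dword (i :: w1 ++ w2) u = Dword (w1 ++ i :: w2) u.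
Proof.
move=> su; elim: w1 => [//|j w1 IH] wk.
rewrite [LHS](Dword_swap _ _ su); last by rewrite addn2.
transitivity (fun x => 'D_(delta_mx j 0) (Dword (i :: w1 ++ w2) u) x) => //.
by rewrite IH// ltnW.
Qed.

(** Swaps of neighbours suffice: the first letter of w is moved to its place in
w', and the rest is handled by induction. *)
Lemma Dword_perm k u w w' : smooth k u -> perm_eq w w' -> (size w <= k)%N ->
  Dword w u = Dword w' u.
Proof.
move=> su; elim: w w' => [|i w IH] w' pw wk.
  by move: pw; rewrite perm_sym => /perm_nilP ->.
have : i \in w' by rewrite -(perm_mem pw) mem_head.
move=> /splitPr hw; case: hw pw => w1 w2 pw.
have pw' : perm_eq w (w1 ++ w2).
  by move: pw; rewrite perm_sym -cat1s perm_catCA cat1s perm_sym perm_cons.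
rewrite -(Dword_move (k := k)) //; last by rewrite /= -(perm_size pw').
by rewrite /= (IH _ pw' (ltnW wk)).
Qed.

(** The q-th derivative along y of the derivative of u of word w, as a sum over
all words; it carries w so that its derivative along y is again of this
form. *)
Fixpoint Dpow y (q : nat) w u x : R :=
  match q with
  | 0 => Dword w u x
  | q'.+1 => \sum_i y i 0 * Dpow y q' (i :: w) u x
  end.

Lemma vector_sum_delta y : y = \sum_i y i 0 *: delta_mx i 0.
Proof.
apply/colP => i; rewrite summxE (bigD1 i)//= big1 ?addr0 => [|j ji].
  by rewrite !mxE !eqxx mulr1.
by rewrite !mxE eq_sym (negbTE ji) mulr0.
Qed.

Lemma Dpow_derive k u w q x y (r : R) : smooth k u -> (size w + q < k)%N ->
  is_derive r 1 (fun r : R => Dpow y q w u (x + r *: y))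
    (Dpow y q.+1 w u (x + r *: y)).
Proof.
move=> su; elim: q w => [|q IH] w wk.
  rewrite addn0 in wk; rewrite /=.
  have h := dir_derivative_sum (index_enum 'I_d) (fun i => y i 0)
    (fun i => (su (i :: w) wk).1) (fun i => smooth_dir i su wk).
  rewrite -vector_sum_delta in h.
  exact: (dir_derivative_line x r h).
have h i : is_derive r 1 (fun r : R => y i 0 * Dpow y q (i :: w) u (x + r *: y))
    (y i 0 * Dpow y q.+1 (i :: w) u (x + r *: y)).
  have hi : is_derive r 1 (fun r : R => Dpow y q (i :: w) u (x + r *: y))
    (Dpow y q.+1 (i :: w) u (x + r *: y)) by apply: IH; rewrite /= addSnnS.
  exact: (is_deriveZ (y i 0) hi).
have := is_derive_sum h.
congr (is_derive _ _ _ _).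
by apply/funext => r'; rewrite fct_sumE.
Qed.

Lemma Dpow_le u w q x y (B : R) :
  (forall w', size w' = (size w + q)%N -> `|Dword w' u x| <= B) ->
  `|Dpow y q w u x| <= (\sum_i `|y i 0|) ^+ q * B.
Proof.
elim: q w => [|q IH] w hB; first by rewrite expr0 mul1r hB// addn0.
rewrite /= (le_trans (ler_norm_sum _ _ _))// exprS -mulrA mulr_suml.
apply: ler_sum => i _; rewrite normrM ler_wpM2l//; apply: IH => w' e.
by apply: hB; rewrite e /= addSnnS.
Qed.

Lemma taylor_Dpow u x y (B : R) : smooth 4 u ->
  (forall w x, size w = 4 -> `|Dword w u x| <= B) ->
  `|u (x + y) - (u x + Dpow y 1 [::] u x + 2^-1 * Dpow y 2 [::] u x
     + 6^-1 * Dpow y 3 [::] u x)| <= (\sum_i `|y i 0|) ^+ 4 * B.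
Proof.
move=> su hB.
have := taylor4 (f0 := fun r => Dpow y 0 [::] u (x + r *: y))
  (f4 := fun r => Dpow y 4 [::] u (x + r *: y))
  (B := (\sum_i `|y i 0|) ^+ 4 * B)
  (fun r => @Dpow_derive 4 u [::] 0 x y r su isT)
  (fun r => @Dpow_derive 4 u [::] 1 x y r su isT)
  (fun r => @Dpow_derive 4 u [::] 2 x y r su isT)
  (fun r => @Dpow_derive 4 u [::] 3 x y r su isT).
rewrite scale1r scale0r addr0; apply => r _.
by apply: Dpow_le => w e; exact: hB.
Qed.

Lemma Dword_increment_le k u w x y (B : R) : smooth k u -> (size w < k)%N ->
  (forall w' x, size w' = (size w).+1 -> `|Dword w' u x| <= B) ->
  `|Dword w u (x + y) - Dword w u x| <= (\sum_i `|y i 0|) * B.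
Proof.
move=> su wk hB.
have wk0 : (size w + 0 < k)%N by rewrite addn0.
have := norm_increment_le (B := (\sum_i `|y i 0|) * B)
  (fun r => Dpow_derive x y r su wk0) _ (r := 1).
rewrite /= scale1r scale0r addr0; apply; last by rewrite ler01 lexx.
move=> r _; have := @Dpow_le u w 1 (x + r *: y) y B.
by rewrite expr1; apply => w' e; apply: hB; rewrite e addn1.
Qed.

End Words.

(** * From the space C^4_b to the seminorms *)

Lemma within_continuous_comp {S U X : topologicalType} (A : set S) (B : set X)
    (f : S -> U) (g : X -> S) :
  continuous g -> (forall x, B x -> A (g x)) ->
  {within A, continuous f} -> {within B, continuous (f \o g)}.
Proof.
move=> cg BA /subspace_continuousP cf; apply/subspace_continuousP => x Bx.
move=> O /(cf _ (BA _ Bx)) /= nO; rewrite /fmap /within /=.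
have /cg {}nO : nbhs (g x) (fun y => A y -> O (f y)) by exact: nO.
exact: (filterS (fun y h By => h (BA y By)) nO).
Qed.

Lemma is_derive_quotient {R : realType} (F : R -> R) (s l : R) :
  (F y - F s) / (y - s) @[y --> s^'] --> l -> is_derive s 1 F l.
Proof.
move=> Fl.
have sh : (fun r : R => r + s) @ 0^' --> s^'.
  move=> A sA; rewrite /fmap /=.
  have {}sA : nbhs s (fun y => y != s -> A y) by exact: sA.
  have cs : (fun r : R => r + s) @ (0 : R) --> s.
    by rewrite -[X in _ --> X]add0r; apply: cvgD; [exact: cvg_id|exact: cvg_cst].
  have := cs _ sA; rewrite /fmap /= => h.
  suff : nbhs (0 : R) (fun r => r != 0 -> A (r + s)) by exact.
  apply: (@filterS _ (nbhs (0 : R)) _ _ _ _ h) => r /= {}h r0; apply: h.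
  by rewrite -subr_eq0 addrK.
suff h : (fun k : R => k^-1 *: ((F \o shift s) (k *: 1) - F s)) @ 0^' --> l.
  apply: DeriveDef; first by apply/cvg_ex; eexists; exact: h.
  exact: (cvg_lim (@Rhausdorff R) h).
rewrite (_ : (fun k => _) = (fun y => (F y - F s) / (y - s)) \o (fun r => r + s)).
  exact: (cvg_comp _ _ sh Fl).
by apply/funext => k /=; rewrite addrK [k *: 1]mulr1 [LHS]mulrC.
Qed.

Section CbWords.
Context {R : realType} {d : nat} (T : R) (v : R -> 'cV[R]_d -> R).
Implicit Types (w : seq 'I_d) (b : 'I_d -> nat).

Lemma partialsE w t : partials T (map Some w) v t = Dword w (v t).
Proof.
by elim: w t => [//|i w IH] t; rewrite /= -IH.
Qed.

Lemma smooth_Cb k t : Cb k T v -> t \in `[0, T] -> smooth k (v t).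
Proof.
move=> Cv tT w wk; have [cw _ dw] := Cv (map Some w) ltac:(by rewrite size_map).
split=> [x|wk' i x].
  rewrite -(partialsE w t).
  have ct : continuous (fun x : 'cV[R]_d => (t, x)).
    move=> y U [[A B] /= [nA nB] AB]; apply: (@filterS _ (nbhs y) _ _ _ _ nB) => z Bz.
    by apply: AB; split=> //=; exact: nbhs_singleton.
  have := within_continuous_comp (B := setT) ct _ cw.
  move=> /(_ (fun y _ => conj tT I)) h; exact: ((continuous_subspace_setT _).2 h x).
have := dw ltac:(by rewrite size_map) (Some i) t x tT.
by rewrite /has_partial partialsE.
Qed.

(** The space part of [deriv_word]: the ordering of the letters used by the
seminorms. *)
Definition sorted_word b : seq 'I_d := flatten [seq nseq (b i) i | i <- enum 'I_d].

Lemma deriv_wordE p b : deriv_word p b = nseq p None ++ map Some (sorted_word b).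
Proof.
rewrite /deriv_word map_flatten -map_comp; congr (_ ++ flatten _).
by apply: eq_map => i /=; rewrite map_nseq.
Qed.

Lemma size_sorted_word b : size (sorted_word b) = (\sum_i b i)%N.
Proof.
rewrite size_flatten /shape -map_comp sumnE big_map big_enum /=.
by apply: eq_bigr => i _; rewrite size_nseq.
Qed.

Lemma perm_sorted_word w : perm_eq w (sorted_word (fun i => count_mem i w)).
Proof.
apply/allP => j _ /=; apply/eqP.
rewrite count_flatten -map_comp sumnE big_map big_enum /= (bigD1 j)//= big1 => [|i ij].
  by rewrite addn0 count_nseq /= eqxx mul1n.
by rewrite count_nseq /= (negbTE ij).
Qed.

Lemma sum_count_mem w : (\sum_i count_mem i w = size w)%N.
Proof. by rewrite -size_sorted_word (perm_size (perm_sorted_word w)). Qed.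

(** The bounds of [Cb] are given word by word; only finitely many words have
length p + q. *)
Lemma seminorm_has_ub k p q : Cb k T v -> (p + q <= k)%N ->
  has_ubound [set y : R | exists t x (beta : 'I_d -> nat),
    [/\ t \in `[0, T], (\sum_i beta i)%N = q &
        y = `|partials T (deriv_word p beta) v t x|]].
Proof.
move=> Cv pqk.
have /choice[B hB] : forall w : (p + q).-tuple (option 'I_d), exists B : R,
    forall t x, t \in `[0, T] -> `|partials T w v t x| <= B.
  by move=> w; have [_ [B hB] _] := Cv w ltac:(by rewrite size_tuple); exists B.
exists (\sum_w `|B w|) => y [t [x [b [tT bq ->]]]].
have sw : size (deriv_word p b) == (p + q)%N.
  by rewrite deriv_wordE size_cat size_nseq size_map size_sorted_word bq.
have := hB (Tuple sw) t x tT => /= /le_trans; apply.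
rewrite (bigD1 (Tuple sw))//= (le_trans (ler_norm _))// lerDl.
by rewrite sumr_ge0.
Qed.

Lemma seminorm_ub k p q t x b : Cb k T v -> (p + q <= k)%N ->
  t \in `[0, T] -> (\sum_i b i)%N = q ->
  `|partials T (deriv_word p b) v t x| <= seminorm T p q v.
Proof.
move=> Cv pqk tT bq; apply: ub_le_sup; first exact: seminorm_has_ub pqk.
by exists t, x, b.
Qed.

Lemma seminorm_ge0 p q : 0 <= seminorm T p q v.
Proof.
rewrite /seminorm; set S := [set _ | _].
have [[[y Sy] ubS]|nS] := pselect (has_sup S); last by rewrite sup_out.
apply: (@le_trans _ _ y); last exact: ub_le_sup.
by have [t [x [b [_ _ ->]]]] := Sy.
Qed.

Lemma Dword_le_seminorm k t x w : Cb k T v -> (size w <= k)%N ->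
  t \in `[0, T] -> `|Dword w (v t) x| <= seminorm T 0 (size w) v.
Proof.
move=> Cv wk tT.
rewrite (Dword_perm (smooth_Cb Cv tT) (perm_sorted_word w) wk) -partialsE.
rewrite -[map _ _]cat0s -(deriv_wordE 0).
by apply: seminorm_ub Cv _ tT _ => //; exact: sum_count_mem.
Qed.

(** The word is first sorted, because the seminorm bounds the time derivative of
the sorted derivative only.  The mean value theorem needs this time derivative
at interior points, where the one-sided quotient of [has_partial] is
two-sided. *)
Lemma Dword_time_increment k t h x w : Cb k T v -> (size w < k)%N ->
  0 <= t -> 0 < h -> t + h <= T ->
  `|Dword w (v (t + h)) x - Dword w (v t) x| <= h * seminorm T 1 (size w) v.
Proof.
move=> Cv wk t0 h0 thT.
pose b i := count_mem i w.
have bw : size (sorted_word b) = size w.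
  by rewrite (perm_size (perm_sorted_word w)).
have itT s : t <= s <= t + h -> s \in `[0, T].
  by move=> /andP[ts sh]; rewrite in_itv/= (le_trans t0 ts) (le_trans sh).
have [cw _ dw] := Cv (map Some (sorted_word b)) ltac:(by rewrite size_map bw ltnW).
pose F s := partials T (map Some (sorted_word b)) v s x.
pose dF s := partials T (deriv_word 1 b) v s x.
have FE s : t <= s <= t + h -> Dword w (v s) x = F s.
  move=> hs; rewrite /F partialsE.
  by rewrite (Dword_perm (smooth_Cb Cv (itT s hs)) (perm_sorted_word w) (ltnW wk)).
have dFE s : s \in `]t, (t + h)[ -> is_derive s 1 F (dF s).
  rewrite in_itv/= => /andP[ts sh].
  have sT : s \in `[0, T] by apply: itT; rewrite !ltW.
  have := dw ltac:(by rewrite size_map bw) None s x sT.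
  rewrite /has_partial => hc.
  have hl : time_quotient (partials T (map Some (sorted_word b)) v) s x y
      @[y --> within `[0, T] (s^')] --> dF s.
    by rewrite /dF deriv_wordE; exact: hc.
  apply: is_derive_quotient.
  have : nbhs s `[0, T]%classic.
    apply: (@filterS _ _ _ `]t, (t + h)[%classic) => [r|].
      rewrite /= !in_itv/= => /andP[tr rh].
      by rewrite (le_trans t0 (ltW tr)) (le_trans (ltW rh)).
    by apply: near_in_itvoo; rewrite in_itv/= ts.
  move=> nT U nU0; have nU := hl U nU0.
  have {}nU : nbhs s (fun y => y != s -> `[0, T]%classic y ->
     U (time_quotient (partials T (map Some (sorted_word b)) v) s x y)) by exact: nU.
  suff : nbhs s (fun y => y != s -> U ((F y - F s) / (y - s))) by exact.
  by apply: filterS (filterI nT nU) => y [Ty h1] ys; exact: h1.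
have cF : {within `[t, t + h], continuous F}.
  have ct : continuous (fun s : R => (s, x)).
    move=> y U [[A B] /= [nA nB] AB]; apply: (@filterS _ (nbhs y) _ _ _ _ nA) => z Az.
    by apply: AB; split=> //=; exact: nbhs_singleton.
  apply: (within_continuous_comp ct _ cw) => s /=; rewrite in_itv/= => hs.
  by split => //=; exact: itT.
have tth : t < t + h by rewrite ltrDl.
have [s + e] := MVT tth dFE cF.
rewrite in_itv/= => /andP[ts sh].
rewrite !FE ?lexx ?(ltW tth)//.
rewrite e (addrAC t) subrr add0r normrM mulrC (gtr0_norm h0) ler_wpM2l ?(ltW h0)//.
apply: seminorm_ub Cv _ _ _; first by rewrite add1n.
- by apply: itT; rewrite !ltW.
- exact: sum_count_mem.
Qed.
End CbWords.

(** * Norms in finite dimension *)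

Lemma entry_le_mx_norm (R : realType) p q (x : 'M[R]_(p, q)) i j : `|x i j| <= `|x|.
Proof.
rewrite [leRHS]/Num.norm /= mx_normrE.
exact: (le_bigmax_cond _ (fun ij : 'I_p * 'I_q => `|x ij.1 ij.2|) (isT : xpredT (i, j))).
Qed.

Section NormEquiv.
Context {R : realType} {m n : nat}.
Variable N : 'M[R]_(m, n) -> R.
Hypothesis isN : is_norm N.

Let N0 : N 0 = 0.
Proof. by have [_ NZ _] := isN; rewrite -(scale0r 0) NZ normr0 mul0r. Qed.

Let NN x : N (- x) = N x.
Proof. by have [_ NZ _] := isN; rewrite -scaleN1r NZ normrN1 mul1r. Qed.

Let Nge0 x : 0 <= N x.
Proof.
have [_ _ ND] := isN; have := ND x (- x).
by rewrite subrr N0 NN -mulr2n pmulrn_lge0.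
Qed.

Let N_sum (I : Type) (r : seq I) (f : I -> 'M[R]_(m, n)) :
  N (\sum_(i <- r) f i) <= \sum_(i <- r) N (f i).
Proof.
have [_ _ ND] := isN; elim: r => [|i r IH]; first by rewrite !big_nil N0.
by rewrite !big_cons (le_trans (ND _ _))// lerD2l.
Qed.

(** N is continuous and positive on the unit sphere of the norm of the maximum,
which is compact, so it has there a positive minimum. *)
Lemma entries_le_norm : exists2 c, 0 <= c &
  forall (x : 'M[R]_(m, n)) i j, `|x i j| <= c * N x.
Proof.
have [i0|nij] := pselect (exists ij : 'I_m * 'I_n, True); last first.
  by exists 0 => // x i j; exfalso; apply: nij; exists (i, j).
have [[i j] _] := i0.
have [N_eq0 NZ ND] := isN.
pose f (v : 'rV[R]_(m * n)) := N (vec_mx v).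
pose L := \sum_i \sum_j N (delta_mx i j).
have L0 : 0 <= L by apply: sumr_ge0 => i' _; apply: sumr_ge0.
have fL v : f v <= L * `|v|.
  rewrite /f {1}(matrix_sum_delta (vec_mx v)).
  rewrite (le_trans (N_sum _ _))// mulr_suml; apply: ler_sum => k _.
  rewrite (le_trans (N_sum _ _))// mulr_suml; apply: ler_sum => k' _.
  by rewrite NZ mulrC ler_wpM2l// mxE entry_le_mx_norm.
have fB v w : `|f v - f w| <= f (v - w).
  have h a b : f a - f b <= f (a - b).
    by rewrite lerBlDr /f linearB -{1}(subrK (vec_mx b) (vec_mx a)) ND.
  by rewrite ler_norml h andbT lerNl opprB (le_trans (h _ _))// /f -NN -linearN opprB.
have cf : continuous f.
  move=> v; apply/(@cvgrPdist_lt _ _ _ (nbhs v) (nbhs_filter v)) => e e0.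
  have d0 : 0 < e / (L + 1) by rewrite divr_gt0// ltr_wpDl.
  have nd : nbhs v (fun w => `|v - w| < e / (L + 1)).
    have := @nbhs_normP R 'rV[R]_(m * n) v (fun w => `|v - w| < e / (L + 1)).
    by move=> [_]; apply; exists (e / (L + 1)).
  apply: (@filterS _ (nbhs v) _ _ _ _ nd) => w hw.
  apply: (le_lt_trans (fB _ _)); apply: (le_lt_trans (fL _)).
  rewrite (@le_lt_trans _ _ ((L + 1) * `|v - w|))//.
    by rewrite ler_wpM2r// lerDl.
  by rewrite mulrC -ltr_pdivlMr ?ltr_wpDl.
pose A := [set v : 'rV[R]_(m * n) | `|v| = 1].
have cA : compact A.
  apply: bounded_closed_compact.
    by exists 1; split => // M M1 v /= ->; exact: ltW.
  apply: (preimage_closed _ (@closed_eq R 1)).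
  by move=> v _; exact: (@norm_continuous R 'rV[R]_(m * n) v).
have nrm (v : 'rV[R]_(m * n)) : v != 0 -> A (`|v|^-1 *: v).
  move=> v0; rewrite /A /= normrZ normfV normr_id mulVf//.
  by rewrite normr_eq0.
have A0 : A !=set0.
  exists (`|mxvec (delta_mx i j : 'M[R]_(m, n))|^-1 *: mxvec (delta_mx i j)).
  apply: nrm; apply/eqP => /(congr1 vec_mx); rewrite mxvecK linear0.
  by move/matrixP/(_ i j)/eqP; rewrite !mxE !eqxx oner_eq0.
have [v0 Av0 minv] := EVT_min_rV A0 cA (continuous_subspaceT cf).
rewrite inE in Av0.
have mu0 : 0 < f v0.
  rewrite lt_neqAle Nge0 andbT eq_sym; apply/eqP => /N_eq0 e.
  move: Av0; rewrite /A /= -[v0]vec_mxK e linear0 normr0 => /eqP.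
  by rewrite eq_sym oner_eq0.
exists (f v0)^-1; first by rewrite invr_ge0 ltW.
move=> x i' j'; rewrite mulrC ler_pdivlMr//.
have -> : `|x i' j'| = `|mxvec x 0 (mxvec_index i' j')| by rewrite mxvecE.
apply: (@le_trans _ _ (`|mxvec x| * f v0)).
  by rewrite ler_wpM2r ?(ltW mu0)// entry_le_mx_norm.
have [->|x0] := eqVneq (mxvec x) 0; first by rewrite normr0 mul0r.
have := minv _ (mem_set (nrm _ x0)).
rewrite /f linearZ/= NZ mxvecK normfV normr_id mulrC ler_pdivlMr//.
  by rewrite mulrC.
by rewrite normr_gt0.
Qed.

End NormEquiv.

(** * Continuous functions of a random vector *)

Section Measurability.
Context {R : realType} {n : nat} {d : measure_display}.
Context {Omega : measurableType d} (Y : Omega -> 'cV[R]_n).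
Hypothesis mY : forall i, measurable_fun setT (fun w => Y w i 0).

Let box (q : 'cV[rat]_n) (k : nat) : set 'cV[R]_n :=
  [set z | forall i, `|z i 0 - ratr (q i 0)| < k.+1%:R^-1].

Let measurable_box q k : measurable (Y @^-1` box q k).
Proof.
have -> : Y @^-1` box q k = \bigcap_(i in setT)
   ((fun w => `|Y w i 0 - ratr (q i 0)|) @^-1` `]-oo, k.+1%:R^-1[).
  apply/seteqP; split=> w /= h i => [_|]; first by rewrite /= in_itv/= h.
  by have := h i I; rewrite /= in_itv.
apply: fin_bigcap_measurable => // i _.
rewrite -[X in measurable X]setTI.
have mi : measurable_fun setT (fun w => `|Y w i 0 - ratr (q i 0)|).
  by apply: measurableT_comp => //; exact: measurable_funB.
exact: mi.
Qed.

(** An open set is a countable union of boxes with rational centres. *)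
Lemma measurable_open_preimage (O : set 'cV[R]_n) : open O ->
  measurable (Y @^-1` O).
Proof.
move=> oO.
have OE : Y @^-1` O = \bigcup_(p : 'cV[rat]_n * nat)
    (if pselect (box p.1 p.2 `<=` O) then Y @^-1` box p.1 p.2 else set0).
  apply/seteqP; split=> w /=; last first.
    by move=> [p _]; case: pselect => // h /h.
  move=> Ow; have := open_nbhs_nbhs (conj oO Ow).
  move=> /(@nbhs_ballP R 'cV[R]_n)[e /= e0 he].
  have [k hk] : exists k : nat, k.+1%:R^-1 < e / 2.
    exists (Num.truncn (e / 2)^-1).
    by rewrite invf_plt ?posrE ?divr_gt0// truncnS_gt.
  have k0 : 0 < k.+1%:R^-1 :> R by rewrite invr_gt0.
  have /choice[q hq] : forall i, exists q : rat,
      `|Y w i 0 - ratr q| < k.+1%:R^-1.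
    move=> i; have : Y w i 0 - k.+1%:R^-1 < Y w i 0 + k.+1%:R^-1.
      by rewrite ltrBlDr -addrA ltrDl addr_gt0.
    move=> /rat_in_itvoo[q]; rewrite in_itv/= => hq; exists q.
    by rewrite distrC ltr_distl.
  exists (\col_i q i, k) => //=.
  have hb : box (\col_i q i) k (Y w) by move=> i; rewrite mxE.
  case: pselect => // -[]; move=> z hz; apply: he.
  split => // i j; rewrite ord1 /ball/=.
  have := hz i; have := hb i; rewrite !mxE => h1 h2.
  rewrite -(subrKA (ratr (q i))) (le_lt_trans (ler_normD _ _))// [e]splitr.
  by rewrite ltrD// ?(lt_trans h1)// distrC (lt_trans h2).
rewrite OE; apply: countable_bigcupT_measurable => [|p]; first exact: countableP.
by case: pselect => bO; [exact: measurable_box|exact: measurable0].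
Qed.

Lemma measurable_continuous_comp (u : 'cV[R]_n -> R) : continuous u ->
  measurable_fun setT (u \o Y).
Proof.
move=> /continuousP cu; apply: (measurability _ (RGenOpens.measurableE R)).
move=> _ [_ [a [b ->] <-]]; rewrite setTI.
apply: (@measurable_open_preimage (u @^-1` `]a, b[)).
exact/cu/interval_open.
Qed.
End Measurability.

(** * One step of the scheme *)

Section OneStep.
Context {R : realType} {n : nat} {d : measure_display}.
Context {Omega : measurableType d}.
Variables (P : probability Omega R) (Z : 'I_n -> Omega -> R).
Hypothesis hZ : forall b : 'I_n -> nat,
  has_mean P (fun w => \prod_i Z i w ^+ b i) (\prod_i normal_moment R (b i)).
Context {l : nat}.
Variables (Sigma : 'M[R]_(n, l)) (k : nat) (r : R) (s : 'M[R]_n).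
Let zv w : 'cV[R]_n := \col_i Z i w.
Let y w : 'cV[R]_n := s *m (r *: zv w).
Let Q w := P2 Sigma k (zv w).

Let yE w i : y w i 0 = \sum_a (r * s i a) * Z a w.
Proof. by rewrite mxE; apply: eq_bigr => a _; rewrite !mxE; ring. Qed.

Let has_mean_step (f : Omega -> R) (m : 'I_n -> R) i :
  (forall a, has_mean P (fun w => Z a w * f w) (m a)) ->
  has_mean P (fun w => y w i 0 * f w) (\sum_a (r * s i a) * m a).
Proof.
move=> h; rewrite (_ : (fun w => _) =
    fun w => \sum_a (r * s i a) * (Z a w * f w)).
  by apply: has_mean_sum => a; apply: has_meanZ.
by apply/funext => w; rewrite yE mulr_suml; apply: eq_bigr => a _; rewrite mulrA.
Qed.

Lemma has_mean_step1_P2 i : has_mean P (fun w => y w i 0 * Q w) 0.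
Proof.
have := has_mean_step i (fun a => has_mean_P2_1 hZ Sigma k a).
by rewrite big1// => a _; rewrite mulr0.
Qed.

Lemma has_mean_step3_P2 i j m :
  has_mean P (fun w => y w i 0 * (y w j 0 * (y w m 0 * Q w))) 0.
Proof.
have h1 a b : has_mean P (fun w => Z a w * (Z b w * (y w m 0 * Q w))) 0.
  have := has_mean_step (f := fun w => Z a w * Z b w * Q w) (m := fun=> 0) m _.
  rewrite big1 => [h|e _]; last by rewrite mulr0.
  have {}h := h (fun e => _).
  rewrite (_ : (fun w => _) = fun w => y w m 0 * (Z a w * Z b w * Q w)).
    apply: h => e; rewrite (_ : (fun w => _) = fun w => Z e w * Z a w * Z b w * Q w).
      exact: has_mean_P2_3.
    by apply/funext => w; rewrite !mulrA.
  by apply/funext => w; ring.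
have h2 a : has_mean P (fun w => Z a w * (y w j 0 * (y w m 0 * Q w))) 0.
  have := has_mean_step (f := fun w => Z a w * (y w m 0 * Q w)) (m := fun=> 0) j _.
  rewrite big1 => [h|e _]; last by rewrite mulr0.
  rewrite (_ : (fun w => _) = fun w => y w j 0 * (Z a w * (y w m 0 * Q w))).
    by apply: h => e; exact: h1.
  by apply/funext => w; ring.
have := has_mean_step i h2.
by rewrite big1// => a _; rewrite mulr0.
Qed.

Lemma has_mean_step2_P2 i j : has_mean P (fun w => y w i 0 * (y w j 0 * Q w))
  (r ^+ 2 * (s *m Sigma *m Sigma^T *m s^T) i j).
Proof.
have h1 a : has_mean P (fun w => Z a w * (y w j 0 * Q w))
    (\sum_b (r * s j b) * (Sigma *m Sigma^T) b a).
  have := has_mean_step (f := fun w => Z a w * Q w)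
    (m := fun b => (Sigma *m Sigma^T) b a) j _.
  move=> h; rewrite (_ : (fun w => _) = fun w => y w j 0 * (Z a w * Q w)).
    apply: h => b; rewrite (_ : (fun w => _) = fun w => Z b w * Z a w * Q w).
      exact: has_mean_P2_2.
    by apply/funext => w; rewrite mulrA.
  by apply/funext => w; ring.
have := has_mean_step i h1.
rewrite [X in has_mean _ _ X -> _](_ : _ =
  r ^+ 2 * (s *m Sigma *m Sigma^T *m s^T) i j)//.
have -> : s *m Sigma *m Sigma^T *m s^T = s *m (s *m (Sigma *m Sigma^T))^T.
  by rewrite !trmx_mul trmxK !mulmxA.
rewrite mxE mulr_sumr; apply: eq_bigr => a _.
rewrite [in RHS]mxE [in RHS]mxE !mulr_sumr; apply: eq_bigr => b _.
by ring.
Qed.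

Lemma measurable_Z i : measurable_fun setT (Z i).
Proof. by have := has_mean_pow hZ i 1; move/has_mean_measurable. Qed.

(** Here r is sqrt h.  The Taylor polynomial is exactly of the form treated by the
three moment identities above; the remainder is bounded by B times the fourth
power of sum_i |y_i| <= r n A sum_a |Z_a|. *)
Lemma one_step_expansion (u : 'cV[R]_n -> R) (x : 'cV[R]_n) (A B : R) :
  (0 < n)%N -> smooth 4 u -> (forall w x, size w = 4 -> `|Dword w u x| <= B) ->
  0 <= r -> (forall i j, `|s i j| <= A) ->
  exists2 m, has_mean P (fun w => u (x + y w) * Q w) m &
  `|m - 2^-1 * (r ^+ 2 * \sum_i \sum_j (s *m Sigma *m Sigma^T *m s^T) i j *
     Dword [:: j; i] u x)| <=
  (r * (n%:R * A)) ^+ 4 * B * (\tr (Sigma *m Sigma^T) * @P2_moment_bound R n k).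
Proof.
move=> n0 su hB r0 hA.
pose G := s *m Sigma *m Sigma^T *m s^T.
have sum0 : 0 = \sum_(i < n) (0 : R) by rewrite big1.
have h0 : has_mean P (fun w => u x * Q w) 0.
  by rewrite -(mulr0 (u x)); apply: has_meanZ; exact: has_mean_P2_0.
have h1 : has_mean P (fun w => Dpow (y w) 1 [::] u x * Q w) 0.
  rewrite [X in has_mean _ _ X]sum0 (_ : (fun w => _) =
    fun w => \sum_i Dword [:: i] u x * (y w i 0 * Q w)).
    apply: has_mean_sum => i; rewrite -(mulr0 (Dword [:: i] u x)).
    by apply: has_meanZ; exact: has_mean_step1_P2.
  apply/funext => w; rewrite mulr_suml; apply: eq_bigr => i _.
  by rewrite /=; ring.
have h2 : has_mean P (fun w => Dpow (y w) 2 [::] u x * Q w)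
    (\sum_i \sum_j Dword [:: j; i] u x * (r ^+ 2 * G i j)).
  rewrite (_ : (fun w => _) =
    fun w => \sum_i \sum_j Dword [:: j; i] u x * (y w i 0 * (y w j 0 * Q w))).
    by do 2 apply: has_mean_sum => ?; apply: has_meanZ; exact: has_mean_step2_P2.
  apply/funext => w; rewrite mulr_suml; apply: eq_bigr => i _.
  rewrite mulr_sumr mulr_suml; apply: eq_bigr => j _.
  by rewrite -/(Dword [:: j; i] u x); ring.
have h3 : has_mean P (fun w => Dpow (y w) 3 [::] u x * Q w) 0.
  rewrite [X in has_mean _ _ X]sum0 (_ : (fun w => _) =
    fun w => \sum_i \sum_j \sum_m
      Dword [:: m; j; i] u x * (y w i 0 * (y w j 0 * (y w m 0 * Q w)))).
    apply: has_mean_sum => i.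
    rewrite [X in has_mean _ _ X]sum0; apply: has_mean_sum => j.
    rewrite [X in has_mean _ _ X]sum0; apply: has_mean_sum => m.
    rewrite -(mulr0 (Dword [:: m; j; i] u x)).
    by apply: has_meanZ; exact: has_mean_step3_P2.
  apply/funext => w; rewrite mulr_suml; apply: eq_bigr => i _.
  rewrite mulr_sumr mulr_suml; apply: eq_bigr => j _.
  rewrite 2!mulr_sumr mulr_suml; apply: eq_bigr => m _.
  by rewrite -/(Dword [:: m; j; i] u x); ring.
pose tay w := u x + Dpow (y w) 1 [::] u x + 2^-1 * Dpow (y w) 2 [::] u x
  + 6^-1 * Dpow (y w) 3 [::] u x.
have ht : has_mean P (fun w => tay w * Q w)
    (2^-1 * \sum_i \sum_j Dword [:: j; i] u x * (r ^+ 2 * G i j)).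
  have := has_meanD (has_meanD (has_meanD h0 h1) (has_meanZ 2^-1 h2))
    (has_meanZ 6^-1 h3).
  rewrite !add0r mulr0 addr0; congr (has_mean _ _ _).
  by apply/funext => w; rewrite /tay; ring.
have my : measurable_fun setT (fun w => u (x + y w) * Q w).
  apply: measurable_funM; last exact: has_mean_measurable (has_mean_P2_0 hZ Sigma k).
  apply: (measurable_continuous_comp (Y := fun w => x + y w)).
    move=> i; under eq_fun do rewrite mxE yE.
    apply: measurable_funD => //; apply: measurable_sum => a.
    by apply: measurable_funM => //; exact: measurable_Z.
  exact: (su [::] isT).1.
have [Gw hG hGm] := P2_fourth_moment hZ Sigma k.
have [m' hm' hm'b] : exists2 m', has_mean P (fun w => u (x + y w) * Q w - tay w * Q w) m'
   & `|m'| <= (r * (n%:R * A)) ^+ 4 * B * (\tr (Sigma *m Sigma^T) * @P2_moment_bound R n k).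
  apply: has_mean_norm_le (has_meanZ _ hGm).
    by apply: measurable_funB my (has_mean_measurable ht).
  move=> w; rewrite -mulrBl normrM.
  have := taylor_Dpow x (y w) su hB; rewrite -/(tay w).
  move=> /(ler_wpM2r (normr_ge0 (Q w))) /le_trans; apply.
  have B0 : 0 <= B.
    by apply: le_trans (hB (nseq 4 (Ordinal n0)) x _); rewrite ?size_nseq.
  have A0 : 0 <= A by apply: le_trans (hA (Ordinal n0) (Ordinal n0)).
  have le1 : \sum_i `|y w i 0| <= (r * (n%:R * A)) * \sum_a `|Z a w|.
    apply: (@le_trans _ _ (\sum_(i < n) (r * A * \sum_a `|Z a w|))).
      apply: ler_sum => i _; rewrite yE (le_trans (ler_norm_sum _ _ _))// mulr_sumr.
      apply: ler_sum => a _; rewrite !normrM (ger0_norm r0).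
      by rewrite ler_wpM2r// ler_wpM2l.
    by rewrite sumr_const card_ord -mulr_natl le_eqVlt; apply/orP; left; apply/eqP; ring.
  have le2 := lerXn2r 4 _ _ le1.
  rewrite mulrAC (le_trans (ler_wpM2r B0 (ler_wpM2r (normr_ge0 _) (le2 _ _))))//.
  - by rewrite nnegrE sumr_ge0.
  - by rewrite nnegrE mulr_ge0 ?sumr_ge0// !mulr_ge0.
  rewrite exprMn (_ : _ * _ * _ * B = (r * (n%:R * A)) ^+ 4 * B *
    ((\sum_a `|Z a w|) ^+ 4 * `|Q w|)); last by ring.
  by rewrite ler_wpM2l ?hG// mulr_ge0// exprn_ge0// !mulr_ge0.
exists (m' + 2^-1 * \sum_i \sum_j Dword [:: j; i] u x * (r ^+ 2 * G i j)).
  have := has_meanD hm' ht; congr (has_mean _ _ _).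
  by apply/funext => w; rewrite subrK.
have -> : r ^+ 2 * \sum_i \sum_j G i j * Dword [:: j; i] u x =
    \sum_i \sum_j Dword [:: j; i] u x * (r ^+ 2 * G i j).
  rewrite mulr_sumr; apply: eq_bigr => i _; rewrite mulr_sumr.
  by apply: eq_bigr => j _; ring.
by rewrite addrK.
Qed.

End OneStep.

Section Euler.
Context {R : realType} {n : nat} {d : measure_display}.
Context {Omega : measurableType d} (P : probability Omega R).
Variables (T h : R) (f : 'cV[R]_n -> 'cV[R]_n) (sigma : 'cV[R]_n -> 'M[R]_n).
Variable (W : R -> Omega -> 'cV[R]_n).
Hypothesis h0 : 0 < h.

(** The i-th iterate of the scheme started from x0 at the time i0 h. *)
Fixpoint euler_iter (i0 : nat) (x0 : 'cV[R]_n) (i : nat) (w : Omega) : 'cV[R]_n :=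
  match i with
  | 0 => x0
  | j.+1 => let x := euler_iter i0 x0 j w in
    let t := (i0 + j)%:R * h in
    x + h *: f x + sigma x *m increment W t (t + h) w
  end.

(** A time is turned into an iteration number by truncating its quotient by h,
which is exact on the grid. *)
Lemma euler_scheme_exists t0 x0 : grid T h t0 ->
  exists X, euler_scheme T h f sigma W t0 x0 X.
Proof.
move=> [i0 e0 _].
have idx i : Num.truncn (i%:R * h / h) = i by rewrite mulfK ?gt_eqF// natrK.
exists (fun t => euler_iter i0 x0 (Num.truncn (t / h) - i0)); split.
  by move=> w; rewrite e0 idx subnn.
move=> t w [i -> _]; rewrite e0 ler_pM2r// ler_nat => le_i0i.
have -> : i%:R * h + h = i.+1%:R * h by rewrite -natr1 mulrDl mul1r.
by rewrite !idx subSn//= subnKC// -natr1 mulrDl mul1r.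
Qed.

(** For the scheme started at t, X t is the constant x, and the defining identity
of the conditional expectation on the whole space determines g x. *)
Lemma euler_cond_exp_value (v : R -> 'cV[R]_n -> R) (Q : 'cV[R]_n -> R) t g x :
  grid T h t -> is_euler_cond_exp P T h f sigma W v Q t g ->
  ((g x)%:E = \int[P]_w (v (t + h)
     (x + h *: f x + sigma x *m increment W t (t + h) w) *
     Q ((Num.sqrt h)^-1 *: increment W t (t + h) w))%:E)%E.
Proof.
move=> gt hg.
have [X [Xt Xh]] := euler_scheme_exists x gt.
have [_ _ hint] := hg t x X gt (lexx t) (conj Xt Xh).
have bT : borel [set: 'cV[R]_n] by apply: sub_sigma_algebra; exact: openT.
have := hint _ bT; rewrite preimage_setT.
under eq_integral do rewrite Xt.
rewrite integral_cst//= probability_setT mule1 => ->.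
by apply: eq_integral => w _; rewrite Xh// Xt.
Qed.

End Euler.

Lemma P2_moment_bound_ge0 (R : realType) n k : 0 <= @P2_moment_bound R n k.
Proof.
have e4 : 0 <= normal_moment R 4 by apply/ltW/normal_moment_even_gt0.
have e6 : 0 <= normal_moment R (4 * k + 6).
  by apply/ltW/normal_moment_even_gt0; rewrite oddD oddM.
by rewrite addr_ge0// !mulr_ge0// ?c__ge0 ?exprn_ge0// invr_ge0.
Qed.

Lemma abs_conj_entry_le (R : realType) n (s G : 'M[R]_n) (A M : R) i j :
  (forall i j, `|s i j| <= A) -> (forall i j, `|G i j| <= M) ->
  `|(s *m G *m s^T) i j| <= n%:R ^+ 2 * (A ^+ 2 * M).
Proof.
move=> hs hG.
have A0 : 0 <= A by apply: le_trans (hs i j).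
have M0 : 0 <= M by apply: le_trans (hG i j).
have le_sum (F : 'I_n -> R) (c : R) : (forall a, `|F a| <= c) ->
    `|\sum_a F a| <= n%:R * c.
  move=> hF; rewrite (le_trans (ler_norm_sum _ _ _))//.
  rewrite (le_trans (ler_sum _ (fun a _ => hF a)))//.
  by rewrite sumr_const card_ord mulr_natl.
rewrite mxE expr2 -mulrA; apply: (le_sum) => b.
rewrite normrM mxE (_ : n%:R * (A ^+ 2 * M) = n%:R * (A * M) * A); last by ring.
apply: ler_pM => //; last by rewrite mxE.
by apply: le_sum => a; rewrite normrM; apply: ler_pM.
Qed.

(** * The weak error bound *)

Lemma absorb_seminorms (R : realType) (K1 K2 c S12 S03 S04 : R) :
  0 <= K1 -> 0 <= K2 -> 0 <= c -> 0 <= S12 -> 0 <= S03 -> 0 <= S04 ->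
  K1 * (c * S03 + S12) + K2 * S04 <=
  (1 + K1 * (1 + c) + K2) * (S12 + S03 + S04).
Proof.
move=> K10 K20 c0 S12_0 S03_0 S04_0.
rewrite -subr_ge0 (_ : _ - _ = S12 + S03 + S04 + K1 * c * (S12 + S04)
  + K1 * (S03 + S04) + K2 * (S12 + S03)); last by ring.
apply: addr_ge0; last by apply: mulr_ge0 => //; exact: addr_ge0.
apply: addr_ge0; last by apply: mulr_ge0 => //; exact: addr_ge0.
apply: addr_ge0; first by do 2 apply: addr_ge0 => //.
by apply: mulr_ge0; [exact: mulr_ge0|exact: addr_ge0].
Qed.

Theorem theorem3p1 (R : realType) (d k : nat) (hd : (1 <= d)%N)
    (normV : 'cV[R]_d -> R) (normM : 'M[R]_d -> R)
    (hnormV : is_norm normV) (hnormM : is_norm normM) (C M : R) :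
  exists K : R, 0 < K /\
  forall (T h : R), 0 < T -> 0 < h -> (exists n : nat, T / h = n%:R) ->
  forall (l : nat) (Sigma : 'M[R]_(d, l)), (l <= d)%N ->
  normM (Sigma *m Sigma^T) <= M ->
  forall (f : 'cV[R]_d -> 'cV[R]_d) (sigma : 'cV[R]_d -> 'M[R]_d),
  (forall x, normV (f x) <= C) -> (forall x, normM (sigma x) <= C) ->
  forall (disp : measure_display) (Omega : measurableType disp)
    (P : probability Omega R) (W : R -> Omega -> 'cV[R]_d),
  brownian_motion P W ->
  forall v : R -> 'cV[R]_d -> R, Cb 4 T v ->
  forall t : R, grid T h t ->
  forall g : 'cV[R]_d -> R,
  is_euler_cond_exp P T h f sigma W v (P2 Sigma k) t g ->
  forall x : 'cV[R]_d,
  `| h^-1 * g x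
     - 2^-1 * \tr (sigma x *m Sigma *m Sigma^T *m (sigma x)^T
                     *m hessian T v t x) |
  <= K * (1 + Num.sqrt h) ^+ 4 *
     (h * (seminorm T 1 2 v + seminorm T 0 3 v + seminorm T 0 4 v)
      + h * Num.sqrt h * seminorm T 1 3 v
      + h ^+ 2 * seminorm T 2 2 v
      + h ^+ 2 * Num.sqrt h * seminorm T 3 1 v
      + h ^+ 3 * seminorm T 4 0 v).
Proof.
have [cV cV0 hcV] := entries_le_norm hnormV.
have [cM cM0 hcM] := entries_le_norm hnormM.
(* F, A and G bound the entries of f, sigma and Sigma Sigma^T. *)
pose F := cV * `|C|; pose A := cM * `|C|; pose G := cM * `|M|.
have F0 : 0 <= F by rewrite mulr_ge0.
have A0 : 0 <= A by rewrite mulr_ge0.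
have G0 : 0 <= G by rewrite mulr_ge0.
pose K1 := (d%:R ^+ 2 * (d%:R ^+ 2 * (A ^+ 2 * G))) : R.
pose K2 := ((d%:R * A) ^+ 4 * (d%:R * G * @P2_moment_bound R d k)) : R.
have K10 : 0 <= K1 by rewrite !mulr_ge0 ?exprn_ge0.
have K20 : 0 <= K2 by rewrite !mulr_ge0 ?exprn_ge0 ?mulr_ge0 ?P2_moment_bound_ge0.
(* K1 is for the displacement of the second derivatives, K2 for the Taylor
   remainder. *)
exists (1 + K1 * (1 + d%:R * F) + K2); split.
  by rewrite -addrA ltr_wpDr// addr_ge0// mulr_ge0// addr_ge0// mulr_ge0.
set K := 1 + _ + K2.
move=> T h T0 h0 _ l Sigma _ hSigma f sigma hf hsigma disp Omega P W bW v Cv t gt g hg x.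
have [i0 ti0 tTh] := gt.
have t0 : 0 <= t by rewrite ti0 mulr_ge0// ltW.
have thT : t + h <= T by rewrite -lerBrDr.
have tT : t \in `[0, T] by rewrite in_itv/= t0 (le_trans _ thT)// lerDl ltW.
have thT' : t + h \in `[0, T] by rewrite in_itv/= thT addr_ge0// ltW.
have fF i : `|f x i 0| <= F.
  by rewrite (le_trans (hcV _ _ _))// ler_wpM2l// (le_trans (hf x))// ler_norm.
have sA i j : `|sigma x i j| <= A.
  by rewrite (le_trans (hcM _ _ _))// ler_wpM2l// (le_trans (hsigma x))// ler_norm.
have SG i j : `|(Sigma *m Sigma^T) i j| <= G.
  by rewrite (le_trans (hcM _ _ _))// ler_wpM2l// (le_trans hSigma)// ler_norm.
set r := Num.sqrt h.
have r0 : 0 < r by rewrite sqrtr_gt0.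
have r2 : r ^+ 2 = h by rewrite sqr_sqrtr// ltW.
pose Z i w := r^-1 * increment W t (t + h) w i 0.
have hZ b := has_mean_increment bW t0 h0 b.
pose u := v (t + h); pose x' := x + h *: f x.
have su : smooth 4 u by exact: smooth_Cb Cv thT'.
set S12 := seminorm T 1 2 v; set S03 := seminorm T 0 3 v.
set S04 := seminorm T 0 4 v.
have hS q w y : (q <= 4)%N -> size w = q -> `|Dword w u y| <= seminorm T 0 q v.
  by move=> q4 e; rewrite -e; apply: (Dword_le_seminorm _ Cv) => //; rewrite e.
have [m hm hmb] := one_step_expansion (Z := Z) hZ Sigma k x' hd su
  (fun w y => @hS 4%N w y isT) (ltW r0) sA.
have gm : g x = m.
  have [_ em] := hm; apply: EFin_inj; rewrite -em.
  rewrite (euler_cond_exp_value h0 x gt hg); apply: eq_integral => w _.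
  have -> : \col_i Z i w = r^-1 *: increment W t (t + h) w.
    by apply/colP => i; rewrite mxE [in RHS]mxE.
  by rewrite scalerA mulfV ?gt_eqF// scale1r.
pose a i j := (sigma x *m Sigma *m Sigma^T *m (sigma x)^T) i j.
have trE : \tr (sigma x *m Sigma *m Sigma^T *m (sigma x)^T *m hessian T v t x) =
    \sum_i \sum_j a i j * Dword [:: j; i] (v t) x.
  apply: eq_bigr => i _; rewrite mxE; apply: eq_bigr => j _.
  by rewrite -(partialsE T v [:: j; i]); congr (_ * _); rewrite mxE.
have aK i j : `|a i j| <= d%:R ^+ 2 * (A ^+ 2 * G).
  rewrite /a -(mulmxA (sigma x)); exact: abs_conj_entry_le.
have trS : \tr (Sigma *m Sigma^T) <= d%:R * G.
  rewrite mulr_natl -[X in _ *+ X]card_ord -sumr_const; apply: ler_sum => i _.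
  exact: le_trans (ler_norm _) (SG i i).
(* From (t + h, x') to (t + h, x), then to (t, x). *)
have dD i j : `|Dword [:: j; i] u x' - Dword [:: j; i] (v t) x| <=
    h * (d%:R * F * S03 + S12).
  rewrite -(subrKA (Dword [:: j; i] u x)) (le_trans (ler_normD _ _))// mulrDr lerD//.
    have h3 w' y : size w' = 3%N -> `|Dword w' u y| <= S03 by exact: (@hS 3%N).
    have := @Dword_increment_le _ _ 4%N u [:: j; i] x (h *: f x) S03 su isT h3.
    move=> /le_trans; apply.
    rewrite mulrA ler_wpM2r ?seminorm_ge0//.
    apply: (@le_trans _ _ (\sum_(i' < d) h * F)).
      apply: ler_sum => i' _; rewrite mxE normrM (gtr0_norm h0).
      by rewrite ler_wpM2l// ltW.
    rewrite sumr_const card_ord le_eqVlt; apply/orP; left; apply/eqP; ring.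
  exact: (@Dword_time_increment _ _ _ _ _ _ _ x [:: j; i] Cv isT t0 h0 thT).
have hmain : `|h^-1 * g x - 2^-1 * \tr (sigma x *m Sigma *m Sigma^T *m
    (sigma x)^T *m hessian T v t x)| <= h * (K1 * (d%:R * F * S03 + S12) + K2 * S04).
  rewrite gm trE; set D := \sum_i \sum_j a i j * Dword [:: j; i] (v t) x.
  set D' := \sum_i \sum_j a i j * Dword [:: j; i] u x'.
  rewrite -/D' r2 in hmb.
  have -> : h^-1 * m - 2^-1 * D = 2^-1 * (D' - D) + h^-1 * (m - 2^-1 * (h * D')).
    by field; rewrite gt_eqF.
  rewrite (le_trans (ler_normD _ _))// [X in _ <= X]mulrDr lerD//.
    rewrite normrM ger0_norm// (le_trans (ler_piMl (normr_ge0 _) _))//.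
      by rewrite invf_le1// ler1n.
    have -> : h * (K1 * (d%:R * F * S03 + S12)) = \sum_(i < d) \sum_(j < d)
        (d%:R ^+ 2 * (A ^+ 2 * G)) * (h * (d%:R * F * S03 + S12)).
      by rewrite !sumr_const card_ord /K1; ring.
    rewrite -sumrB (le_trans (ler_norm_sum _ _ _))//; apply: ler_sum => i _.
    rewrite -sumrB (le_trans (ler_norm_sum _ _ _))//; apply: ler_sum => j _.
    by rewrite -mulrBr normrM ler_pM.
  rewrite normrM normfV (gtr0_norm h0) ler_pdivrMl// (le_trans hmb)//.
  rewrite (_ : h * (h * (K2 * S04)) = (r * (d%:R * A)) ^+ 4 * S04 *
     (d%:R * G * @P2_moment_bound R d k)); last by rewrite /K2 -{1 2}r2; ring.
  rewrite ler_wpM2l ?mulr_ge0 ?exprn_ge0 ?mulr_ge0 ?seminorm_ge0 ?(ltW r0)//.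
  by rewrite ler_wpM2r// P2_moment_bound_ge0.
apply: (le_trans hmain).
have S12_0 : 0 <= S12 by exact: seminorm_ge0.
have S03_0 : 0 <= S03 by exact: seminorm_ge0.
have S04_0 : 0 <= S04 by exact: seminorm_ge0.
have dF0 : 0 <= d%:R * F by rewrite mulr_ge0.
have KE : K1 * (d%:R * F * S03 + S12) + K2 * S04 <= K * (S12 + S03 + S04).
  exact: absorb_seminorms.
have K0 : 0 <= K by rewrite !addr_ge0// mulr_ge0// addr_ge0.
rewrite (le_trans (ler_wpM2l (ltW h0) KE))// mulrCA -mulrA ler_wpM2l//.
have r1 : 1 <= (1 + r) ^+ 4 by rewrite exprn_ege1// lerDl ltW.
have h_ge0 := ltW h0; have r_ge0 := ltW r0.
set E := _ + _ + _ + _ + _.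
have hE : h * (S12 + S03 + S04) <= E.
  rewrite /E -!addrA lerDl.
  apply: addr_ge0; first by apply: mulr_ge0; [exact: mulr_ge0|exact: seminorm_ge0].
  apply: addr_ge0; first by apply: mulr_ge0; [exact: exprn_ge0|exact: seminorm_ge0].
  apply: addr_ge0; last by apply: mulr_ge0; [exact: exprn_ge0|exact: seminorm_ge0].
  apply: mulr_ge0; last exact: seminorm_ge0.
  by apply: mulr_ge0; [exact: exprn_ge0|].
apply: (le_trans hE); rewrite ler_peMl//.
by rewrite (le_trans _ hE)// mulr_ge0// !addr_ge0.
Qed.
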